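(* Let $\lambda$ be a partition and $n\in N(\lambda)$. Then \[\mathrm{ss}_{\lambda,n}=\sum_{\substack{\beta:\ \beta'\text{ even}\\ \nu\in V^n(\lambda)}}c^{\nu}_{\beta\lambda}\,s_\nu .\] In particular, $\mathrm{ss}_{\lambda,n}$ is a finite sum of Schur functions and hence Schur-positive.
   Context: Partitions are Young diagrams; a skew shape is a horizontal strip (resp. vertical strip) if it has at most one box in each column (resp. row). $N(\lambda)=\{n\ge|\lambda|: n\equiv|\lambda|\pmod 2\}$. $\beta'$ denotes the conjugate partition; ''$\beta'$ even'' means every part of $\beta'$ is even (every column of $\beta$ has even length). $c^\nu_{\beta\lambda}$ are the Littlewood–Richardson coefficients, $s_\beta s_\lambda=\sum_\nu c^\nu_{\beta\lambda}s_\nu$. $V^n(\lambda)$ is the set of partitions $\nu$ with $|\nu|=n$ for which there is a chain $\lambda=\nu^0\subseteq\nu^1\subseteq\dots\subseteq\nu^t=\nu$ of partitions with each $\nu^s/\nu^{s-1}$ a vertical strip of even size. An SSOT of shape $\lambda$ is a sequence of partitions $S=(S^1,S'^2,S^2,S'^3,\dots)$ such that, with $S^0=S'^1=\emptyset$: for all $i\ge1$, $S'^i\subseteq S^{i-1}$, $S'^i\subseteq S^i$, and $S^{i-1}/S'^i$, $S^i/S'^i$ are horizontal strips (possibly empty); and $S^i=S'^{i+1}=\lambda$ for all large $i$. Put $m_i(S)=|S^{i-1}/S'^i|+|S^i/S'^i|$, length $n=\sum_i m_i(S)$, $x^S=\prod_ix_i^{m_i(S)}$. $\mathrm{ss}_{\lambda,n}(x)=\sum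 x^S$ over SSOTs of shape $\lambda$ and length $n$ (infinitely many variables). *)

(* Defs.v *)
From HB Require Import structures.
From mathcomp Require Import all_boot all_order all_algebra.
From mathcomp Require Import finmap multiset.
From mathcomp Require Import boolp classical_sets functions cardinality fsbigop.

Set Implicit Arguments.
Unset Strict Implicit.
Unset Printing Implicit Defensive.

Import Order.TTheory GRing.Theory Num.Theory.

Local Open Scope classical_set_scope.
Local Open Scope ring_scope.

(** * Partitions *)

Definition is_part (s : seq nat) : bool := sorted geq s && (0%N \notin s).

Record intpart := IntPart { parts :> seq nat; partsP : is_part parts }.

HB.instance Definition _ := [isSub for parts].
HB.instance Definition _ := [Choice of intpart by <:].

Definition part0 : intpart := @IntPart [::] isT.

Definition psize (la : intpart) : nat := sumn la.

(* Boxes are (row, column), both counted from 0. *)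
Definition box (la : intpart) (i j : nat) : Prop := (j < nth 0 la i)%N.

Definition pincl (mu la : intpart) : Prop := forall i j, box mu i j -> box la i j.

Definition skew_box (la mu : intpart) (i j : nat) : Prop :=
  box la i j /\ ~ box mu i j.

Definition horizontal_strip (la mu : intpart) : Prop :=
  pincl mu la /\
  forall i1 i2 j, skew_box la mu i1 j -> skew_box la mu i2 j -> i1 = i2.

Definition vertical_strip (la mu : intpart) : Prop :=
  pincl mu la /\
  forall i j1 j2, skew_box la mu i j1 -> skew_box la mu i j2 -> j1 = j2.

(* |la / mu|, used only when mu is contained in la. *)
Definition skew_size (la mu : intpart) : nat := (psize la - psize mu)%N.

Definition conj_seq (s : seq nat) : seq nat :=
  mkseq (fun j => count (fun p => j < p)%N s) (head 0%N s).

Lemma conj_seqP (la : intpart) : is_part (conj_seq la).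
Proof.
case: la => -[|a s] //= _; apply/andP; split.
  apply: homo_sorted (iota_sorted 0 a) => i j le_ij.
  by apply: sub_count => p; apply: leq_ltn_trans.
apply/negP => /mapP[j]; rewrite mem_iota /= add0n => lt_ja.
by rewrite lt_ja.
Qed.

Definition conj_part (la : intpart) : intpart := IntPart (conj_seqP la).

Definition even_parts (la : intpart) : bool := all (fun p => ~~ odd p) la.

Definition Nset (la : intpart) : set nat :=
  [set n | (psize la <= n)%N /\ (n = psize la %[mod 2])%N].

Definition Vset (n : nat) (la : intpart) : set intpart :=
  [set nu | psize nu = n /\
    exists t : nat, exists c : nat -> intpart,
      [/\ c 0%N = la, c t = nu &
        forall s, (s < t)%N ->
          vertical_strip (c s.+1) (c s) /\ ~~ odd (skew_size (c s.+1) (c s))]].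

(** * Formal power series in infinitely many variables *)

(* The index i : nat stands for the variable x_(i+1); a monomial is the
   multiset of its variables, and a series is its coefficient function. *)
Notation monomial := {mset nat}%mset.
Notation fps := (monomial -> int).

Definition fps_mul (f g : fps) : fps :=
  fun m => \sum_(ab \in [set ab : monomial * monomial | msetD ab.1 ab.2 = m])
             f ab.1 * g ab.2.

(* The sum of x^(w t) for t in A, where w t is a family of exponents; it is
   meaningful when each monomial arises from finitely many t in A, as it does
   in both uses below. *)
Definition gen_series (T : choiceType) (A : set T) (w : T -> nat -> nat) : fps :=
  fun m => (#|` fset_set (A `&` [set t | forall i, w t i = m i]) |)%:Z.

(** * Schur functions and Littlewood-Richardson coefficients *)

(* A tableau is the list of its rows; the entry i stands for i + 1. *)
Definition ssyt (nu : intpart) : set (seq (seq nat)) :=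
  [set T | [/\ map size T = nu, all (sorted leq) T &
    forall i j, (j < size (nth [::] T i.+1))%N ->
      (nth 0 (nth [::] T i) j < nth 0 (nth [::] T i.+1) j)%N]].

Definition schur (nu : intpart) : fps :=
  gen_series (ssyt nu) (fun T i => count_mem i (flatten T)).

Definition schur_expansion (f : fps) (c : intpart -> int) : Prop :=
  finite_set [set nu | c nu != 0] /\
  f = \sum_(nu \in [set: intpart]) schur nu *~ c nu.

(* LR be la is the family nu |-> c^nu_{be,la} of coefficients in the expansion
   of s_be s_la; it is unique since Schur functions are linearly independent. *)
Definition LR (be la : intpart) : intpart -> int :=
  xget (fun=> 0) [set c | schur_expansion (fps_mul (schur be) (schur la)) c].

Definition schur_positive (f : fps) : Prop :=
  exists c, schur_expansion f c /\ forall nu, 0 <= c nu.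

(** * SSOTs *)

(* The pair (S, S') has S.1 i = S^i and S.2 i = S'^(i+1), for i >= 0. *)
Definition oscillation : Type :=
  ((nat -> intpart) * (nat -> intpart))%type.

Definition is_ssot (la : intpart) (S : oscillation) : Prop :=
  [/\ S.1 0%N = part0, S.2 0%N = part0,
      forall i, horizontal_strip (S.1 i) (S.2 i) /\
                horizontal_strip (S.1 i.+1) (S.2 i) &
      exists i0, forall i, (i0 <= i)%N -> S.1 i = la /\ S.2 i = la].

(* ssot_exp S i is m_(i+1)(S), the exponent of x_(i+1). *)
Definition ssot_exp (S : oscillation) (i : nat) : nat :=
  (skew_size (S.1 i) (S.2 i) + skew_size (S.1 i.+1) (S.2 i))%N.

(* The sum is over the finite support of ssot_exp S. *)
Definition ssot_length (S : oscillation) : nat :=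
  \sum_(i \in [set: nat]) ssot_exp S i.

Definition ss (la : intpart) (n : nat) : fps :=
  gen_series [set S | is_ssot la S /\ ssot_length S = n] ssot_exp.

(* Main.v *)
(* Let h_k, s_la be evaluated in finitely many variables and let E_N be the sum of
   the s_be (x_1, ..., x_N) over the be with even columns.

   Stembridge's proof of the Littlewood-Richardson rule gives
   s_be s_la = sum of the s_(la + wt T), over the tableaux T of shape be such that
   la + wt (T restricted to the columns >= j) is a partition for every j.  Adding the
   columns of T to la from right to left exhibits la + wt T as an element of V^n(la)
   when be has even columns, and the rule for be = (k) is Pieri's formula.

   Exactly one partition be with even columns is such that be/mu is a horizontal
   strip, exactly one ga is such that mu/ga is one, and |be/mu| = |mu/ga|.  Hence, with
   y = x_(N+1), Pieri's formula yields E_(N+1) = (sum_k h_k y^k) E_N.  By the same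
   formula, ss_la = E_N s_la implies the identity for N + 1 variables:
     sum_(ka, mu) y^(|la/ka| + |mu/ka|) E_N s_mu
       = E_N (sum_k h_k y^k) sum_ka y^|la/ka| s_ka = E_(N+1) s_la.

   Tableaux are chains of partitions growing by horizontal strips.  Polynomials in
   the x_i are represented in Z[X], with x_i = X^(D^i) for a large D. *)

Require Import Defs.
From mathcomp Require Import all_boot all_order all_algebra.
From mathcomp Require Import fingroup perm finmap multiset.
From mathcomp Require Import boolp classical_sets functions cardinality fsbigop.
From mathcomp Require Import zify ring.

Set Implicit Arguments.
Unset Strict Implicit.
Unset Printing Implicit Defensive.

Import Order.TTheory GRing.Theory Num.Theory.

(** The coefficients [LR] are obtained by choosing some Schur expansion of a product, so a tableau
    rule alone does not compute them: linear independence of the Schur functions is required as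
    well. Stembridge's cancellation pairs off alternants of opposite sign and then divides by the
    Vandermonde determinant. It therefore takes place in an integral domain with 2 != 0 and pairwise
    distinct values of the variables. The substitution in Z[X] meets these demands, and the
    coefficient of a monomial is recovered from base-D digits as soon as D exceeds every exponent in
    play. Hence the number N of variables and the base D are chosen afresh for each monomial, and
    the tableaux that give the rule have to be shown independent of N once N is large. Lengths and
    degrees are fixed throughout, so each identity of generating functions is proved one homogeneous
    component at a time, by finite sums. *)

Local Notation "la ._[ i ]" := (nth 0%N (parts la) i) (at level 2, left associativity, format "la ._[ i ]").

(** * Partitions and horizontal strips *)

Section Partitions.
Local Open Scope nat_scope.
Implicit Types (la mu nu ka : intpart).

Lemma sum_ordS (F : nat -> nat) n : \sum_(i < n.+1) F i = \sum_(i < n) F i + F n.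
Proof. exact: big_ord_recr. Qed.

Lemma part_anti la i j : i <= j -> la._[j] <= la._[i].
Proof.
move=> le_ij; case/andP: (partsP la) => sla _.
case: (ltnP j (size la)) => [ltj|/(nth_default 0) -> //].
apply: (@sorted_leq_nth _ geq) => //.
- by move=> x y z; rewrite /geq /= => h1 h2; apply: leq_trans h2 h1.
- by move=> x; rewrite /geq /=.
- by rewrite inE; apply: leq_ltn_trans ltj.
Qed.

Lemma intpart_gt0 la i : (0 < la._[i]) = (i < size la).
Proof.
case: (ltnP i (size la)) => [lti|/(nth_default 0) -> //].
case/andP: (partsP la) => _ /negP h; rewrite lt0n; apply/eqP => h0.
by apply: h; rewrite -h0 mem_nth.
Qed.

Lemma part_eq0 la i : size la <= i -> la._[i] = 0.
Proof. exact: nth_default. Qed.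

Lemma intpart_eqP la mu : (forall i, la._[i] = mu._[i]) -> la = mu.
Proof.
move=> h; apply: val_inj => /=.
have sz : size la = size mu.
  have := intpart_gt0 la (size mu); have := intpart_gt0 mu (size la).
  by rewrite h -h (part_eq0 (leqnn _)) (part_eq0 (leqnn _)); lia.
by apply: (@eq_from_nth _ 0) => // i _; apply: h.
Qed.

Lemma psizeE la N : size la <= N -> psize la = \sum_(i < N) la._[i].
Proof.
move=> le; rewrite /psize sumnE (big_nth 0) big_mkord (big_ord_widen _ (fun i => la._[i]) le).
rewrite big_mkcond /=; apply: eq_bigr => i _.
by case: ltnP => // /part_eq0.
Qed.

Lemma size_le_psize la : size la <= psize la.
Proof.
rewrite (psizeE (leqnn _)) -[leqLHS]card_ord -sum1_card.
by apply: leq_sum => i _; rewrite intpart_gt0.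
Qed.

Lemma part_le_psize la i : la._[i] <= psize la.
Proof.
rewrite (psizeE (leq_maxl (size la) i.+1)).
by rewrite (bigD1 (Ordinal (leq_maxr (size la) i.+1))) //= leq_addr.
Qed.

Lemma psize_eq0 la : psize la = 0 -> la = part0.
Proof.
by move=> h; apply: intpart_eqP => i; have := part_le_psize la i; rewrite h nth_nil; lia.
Qed.

Lemma part0E i : part0._[i] = 0.
Proof. exact: nth_nil. Qed.

Definition part_of_seq n (f : nat -> nat) := sort geq [seq x <- mkseq f n | x != 0].

Lemma part_of_seqP n f : is_part (part_of_seq n f).
Proof.
apply/andP; split; first by apply: sort_sorted => x y; rewrite /geq /= leq_total.
by rewrite mem_sort mem_filter.
Qed.

Definition part_of n f : intpart := IntPart (part_of_seqP n f).

Lemma part_ofE n f i : (forall j, f j.+1 <= f j) -> f n = 0 -> (part_of n f)._[i] = f i.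
Proof.
move=> fS fn0.
have fanti a b : a <= b -> f b <= f a.
  by move/subnK <-; elim: (b - a) => //= k; rewrite addSn; apply: leq_trans.
pose t := find (fun k => f k == 0) (iota 0 n).
have tn : t <= n by rewrite /t -[leqRHS](size_iota 0) find_size.
have lt_t k : k < t -> f k != 0.
  move=> kt; have := @before_find _ 0 (fun k => f k == 0) (iota 0 n) k kt.
  by rewrite nth_iota ?add0n => [->|]//; lia.
have ft0 : f t = 0.
  have [-> //|lt] := eqVneq t n.
  have /(nth_find 0) : has (fun k => f k == 0) (iota 0 n).
    by rewrite has_find size_iota -/t; lia.
  by rewrite -/t nth_iota ?add0n => [/eqP|]//; lia.
have E : [seq x <- mkseq f n | x != 0] = mkseq f t.
  rewrite /mkseq -{1}(subnKC tn) iotaD map_cat filter_cat.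
  rewrite (_ : filter _ [seq f i | i <- iota 0 t] = [seq f i | i <- iota 0 t]); last first.
    apply/all_filterP/allP => _ /mapP[k + ->]; rewrite mem_iota => /andP[_ kt].
    by apply: lt_t; rewrite add0n in kt.
  rewrite (_ : filter _ _ = [::]) ?cats0 //.
  apply/eqP; rewrite -size_eq0 size_filter -leqn0 leqNgt -has_count -all_predC.
  apply/allP => _ /mapP[k + ->]; rewrite mem_iota => /andP[tk _] /=.
  by have := fanti t k; rewrite ft0; lia.
rewrite /part_of /= /part_of_seq E sorted_sort.
- case: (ltnP i t) => it; first by rewrite nth_mkseq.
  by rewrite nth_default ?size_mkseq //; have := fanti t i; rewrite ft0; lia.
- by move=> x y z; rewrite /geq /= => h1 h2; apply: leq_trans h2 h1.
- by apply: homo_sorted (iota_sorted 0 t) => a b; apply: fanti.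
Qed.

(** A partition of size at most [B] has at most [B] parts, each at most [B], so it comes from a
    [B]-tuple; sorting identifies many tuples, whence [undup]. *)
Definition small_parts B : seq intpart :=
  [seq la <- undup [seq part_of B (fun i => nth 0 (map val (f : B.-tuple 'I_B.+1)) i)
                   | f : B.-tuple 'I_B.+1] | psize la <= B].

Lemma mem_small_parts B la : (la \in small_parts B) = (psize la <= B).
Proof.
rewrite mem_filter mem_undup andbC; case: (leqP (psize la) B) => le; rewrite ?andbT ?andbF //=.
have szB : size la <= B by apply: leq_trans le; apply: size_le_psize.
apply/mapP; exists [tuple (inord la._[i] : 'I_B.+1) | i < B]; first by rewrite mem_enum.
have E i : nth 0 [seq val i | i <- [tuple (inord la._[i] : 'I_B.+1) | i < B]] i = la._[i].
  case: (ltnP i B) => iB; last first.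
    by rewrite nth_default ?part_eq0 ?size_map -?enumT ?size_enum_ord //; lia.
  rewrite (nth_map ord0) ?size_tuple // -[i]/(nat_of_ord (Ordinal iB)) -tnth_nth tnth_mktuple.
  by apply: inordK => /=; have := part_le_psize la i; lia.
apply: intpart_eqP => i; rewrite part_ofE ?E // => [j|]; last by rewrite part_eq0.
by rewrite !E part_anti.
Qed.

Lemma uniq_small_parts B : uniq (small_parts B).
Proof. by rewrite filter_uniq // undup_uniq. Qed.

(** Interlacing of row lengths, a decidable form of [horizontal_strip]; past both lengths all rows
    are 0. *)
Definition hstrip (la mu : intpart) : bool :=
  all (fun i => (mu._[i] <= la._[i]) && (la._[i.+1] <= mu._[i])) (iota 0 (maxn (size la) (size mu))).

Lemma hstripP la mu :
  reflect (forall i, mu._[i] <= la._[i] /\ la._[i.+1] <= mu._[i]) (hstrip la mu).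
Proof.
apply: (iffP allP) => [h i|h i _]; last by apply/andP; apply: h.
case: (ltnP i (maxn (size la) (size mu))) => hi; first by apply/andP/h; rewrite mem_iota.
by rewrite !part_eq0 //; lia.
Qed.

Lemma horizontal_stripP la mu : horizontal_strip la mu <-> hstrip la mu.
Proof.
split=> [[inc one]|/hstripP h].
  apply/hstripP => i; have le k : mu._[k] <= la._[k].
    by rewrite leqNgt; apply/negP => h; have := inc k la._[k] h; rewrite /box; lia.
  split=> //; rewrite leqNgt; apply/negP => h.
  (* Otherwise rows [i] and [i.+1] would both have a box of the skew shape in column [mu._[i]]. *)
  have := one i i.+1 mu._[i]; rewrite /skew_box /box.
  have := part_anti la (leqnSn i); have := part_anti mu (leqnSn i) => h1 h2 h3.
  by have := h3 ltac:(lia) ltac:(lia); lia.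
split=> [i j|i1 i2 j]; rewrite /skew_box /box; first by have := h i; lia.
move=> [a1 b1] [a2 b2].
case: (ltngtP i1 i2) => // lt.
  by have := part_anti la lt; have := h i1; lia.
by have := part_anti la lt; have := h i2; lia.
Qed.

Lemma hstrip_psize la mu : hstrip la mu -> psize mu <= psize la.
Proof.
move/hstripP => h; rewrite (psizeE (leq_maxl (size la) (size mu))) (psizeE (leq_maxr (size la) (size mu))).
by apply: leq_sum => i _; case: (h i).
Qed.

Lemma hstrip_refl la : hstrip la la.
Proof. by apply/hstripP => i; split=> //; apply: part_anti. Qed.

Lemma sub_psize_eq la mu : (forall i, mu._[i] <= la._[i]) -> psize la <= psize mu -> la = mu.
Proof.
move=> h; rewrite (psizeE (leq_maxl (size la) (size mu))) (psizeE (leq_maxr (size la) (size mu))).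
set N := maxn _ _ => le; apply: intpart_eqP => i.
case: (ltnP i N) => iN; last by rewrite !part_eq0 //; lia.
have E nu : \sum_(k < N) nu._[k] = nu._[i] + \sum_(k < N | k != Ordinal iN) nu._[k].
  by rewrite (bigD1 (Ordinal iN)).
move: le; rewrite !E.
have : \sum_(k < N | k != Ordinal iN) mu._[k] <= \sum_(k < N | k != Ordinal iN) la._[k].
  by apply: leq_sum => k _.
by have := h i; lia.
Qed.

Lemma hstrip_size la mu N : hstrip la mu -> size mu <= N -> size la <= N.+1.
Proof.
move=> /hstripP h le; rewrite leqNgt -intpart_gt0; have [_] := h N.
by rewrite (part_eq0 le); lia.
Qed.

Lemma hstrip_sizeW la mu : hstrip la mu -> size mu <= size la.
Proof.
by move=> /hstripP h; rewrite leqNgt -intpart_gt0; have [] := h (size la); rewrite (part_eq0 (leqnn _)); lia.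
Qed.

End Partitions.

(** * Tableaux as chains of partitions *)

Section Paths.
Local Open Scope nat_scope.
Variables (X : choiceType) (x0 : X) (pre : nat -> X -> seq X).

Definition extend N (y : X) (p : nat -> X) : nat -> X := fun k => if k <= N then p k else y.

(** Paths are functions on all of [nat], constant from [N] on, so no bound on the index has to be
    carried along. The predecessors depend on the step because oscillations alternately remove and
    add a strip. *)
Fixpoint paths N y : seq (nat -> X) :=
  if N is N'.+1 then flatten [seq [seq extend N' y p | p <- paths N' x] | x <- pre N' y]
  else if y == x0 then [:: fun=> x0] else [::].

Lemma mem_paths N y p :
  reflect [/\ p 0 = x0, forall k, k < N -> p k \in pre k (p k.+1)
            & forall k, N <= k -> p k = y] (p \in paths N y).
Proof.
elim: N y p => [|N IH] y p /=.
  case: (eqVneq y x0) => [->|ne]; last by constructor=> -[h _ h']; rewrite -h h' // eqxx in ne.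
  rewrite inE; apply: (iffP eqP) => [-> //|[_ _ h]].
  by apply: funext => k; rewrite h.
apply: (iffP flatten_mapP) => [[x xin /mapP[q /IH[q0 qs qe] ->]]|[p0 ps pe]].
  rewrite /extend; split=> [//|k|k Nk]; last by rewrite leqNgt Nk.
  rewrite ltnS => le; rewrite le; case: ltnP => kN; first exact: qs.
  by rewrite (_ : k = N) ?qe //; lia.
exists (p N); first by rewrite -[in pre N y](pe N.+1) //; apply: ps.
apply/mapP; exists (extend N (p N) p).
  apply/IH; rewrite /extend; split=> [//|k kN|k Nk].
    by rewrite (ltnW kN) kN; apply: ps; apply: ltnW.
  by case: ifP => // kN; congr p; apply/eqP; rewrite eqn_leq kN.
by apply: funext => k; rewrite /extend; case: ifP => [-> //|]; case: ltnP => // /pe ->.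
Qed.

Hypothesis pre_uniq : forall t y, uniq (pre t y).

Lemma paths_uniq N y : uniq (paths N y).
Proof.
elim: N y => [|N IH] y /=; first by case: ifP.
rewrite -[flatten _]/(flatten [seq [seq (fun x => extend N y) x p | p <- paths N x] | x <- pre N y]).
rewrite (@allpairs_uniq_dep X (fun _ => nat -> X) (nat -> X) (fun _ p => extend N y p)) // => -[x p] [x' p'].
move=> /allpairsPdep[a [b [ain bin [-> ->]]]] /allpairsPdep[a' [b' [ain' bin' [-> ->]]]] /= E.
have /mem_paths[_ _ be] := bin; have /mem_paths[_ _ be'] := bin'.
have Ek k : k <= N -> b k = b' k.
  by move=> kN; have := congr1 (fun f : nat -> X => f k) E; rewrite /extend kN.
have aa : a = a' by rewrite -(be N) // -(be' N) // Ek.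
suff -> : b = b' by rewrite aa.
apply: funext => k; case: (leqP k N) => [/Ek //|/ltnW kN].
by rewrite be // be' // aa.
Qed.

Lemma big_paths (R : nmodType) N y (F : (nat -> X) -> R) :
  (\sum_(p <- paths N.+1 y) F p =
   \sum_(x <- pre N y) \sum_(p <- paths N x) F (extend N y p))%R.
Proof. by rewrite /= big_flatten big_map; apply: eq_bigr => x _; rewrite big_map. Qed.

End Paths.

Section BigSeq.
Local Open Scope ring_scope.

Lemma big_involution (R : nmodType) (I : eqType) (s : seq I) (Q : pred I) (phi : I -> I) (F : I -> R) :
  uniq s ->
  (forall i, i \in s -> Q i -> [/\ phi i \in s, Q (phi i) & phi (phi i) = i]) ->
  \sum_(i <- s | Q i) F i = \sum_(i <- s | Q i) F (phi i).
Proof.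
move=> us h; rewrite -[LHS]big_filter -[RHS]big_filter -[RHS](big_map phi xpredT).
apply: perm_big; apply: uniq_perm; first by rewrite filter_uniq.
  rewrite map_inj_in_uniq ?filter_uniq // => x y; rewrite !mem_filter.
  by move=> /andP[Qx /h/(_ Qx)[_ _ {2}<-]] /andP[Qy /h/(_ Qy)[_ _ {2}<-]] ->.
move=> x; apply/idP/mapP => [|[y + ->]]; rewrite !mem_filter => /andP[Q1 /h/(_ Q1)[a b c]].
  by exists (phi x); rewrite // mem_filter a b.
by rewrite a b.
Qed.

Lemma big_small_parts (V : nmodType) B (F : intpart -> V) (P Q : pred intpart) C :
  (forall la, P la && (psize la <= B)%N = Q la && (psize la <= C)%N) ->
  \sum_(la <- small_parts B | P la) F la = \sum_(la <- small_parts C | Q la) F la.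
Proof.
move=> h; rewrite -big_filter -[RHS]big_filter; apply: perm_big.
apply: uniq_perm => [||la]; [exact/filter_uniq/uniq_small_parts | exact/filter_uniq/uniq_small_parts |].
by rewrite (mem_filter P) (mem_filter Q) !mem_small_parts h.
Qed.

Lemma big_seq_unique (V : nmodType) (I : eqType) (s : seq I) (P : pred I) (a : I) (F : I -> V) :
  uniq s -> a \in s -> (forall i, P i -> i = a) ->
  \sum_(i <- s | P i) F i = if P a then F a else 0.
Proof.
move=> us ain h; rewrite big_mkcond (bigD1_seq a) //= big1 ?addr0 // => i /eqP ne.
by case: ifP => // /h.
Qed.

End BigSeq.

Section Chains.
Local Open Scope nat_scope.
Implicit Types (la mu nu ka : intpart) (T : nat -> intpart).

Definition removals (_ : nat) nu : seq intpart := [seq ka <- small_parts (psize nu) | hstrip nu ka].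

Lemma mem_removals t nu ka : (ka \in removals t nu) = hstrip nu ka.
Proof. by rewrite mem_filter mem_small_parts; case: (boolP (hstrip nu ka)) => // /hstrip_psize ->. Qed.

(** A chain stands for the tableau with entries below [N] whose entries [k] fill the boxes of
    [T k.+1] outside [T k]; [wt T k] will count them. *)
Definition chains N nu := paths part0 removals N nu.

Lemma chainsP N nu T :
  reflect [/\ T 0 = part0, forall k, hstrip (T k.+1) (T k) & forall k, N <= k -> T k = nu]
    (T \in chains N nu).
Proof.
apply: (iffP (mem_paths _ _ _ _ _)) => -[T0 Ts Te]; split=> // k.
  case: (ltnP k N) => [/Ts|kN]; first by rewrite mem_removals.
  by rewrite !Te ?hstrip_refl //; apply: leqW.
by move=> kN; rewrite mem_removals.
Qed.

Lemma chains_uniq N nu : uniq (chains N nu).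
Proof. by apply: paths_uniq => t y; rewrite filter_uniq // uniq_small_parts. Qed.

Lemma chain_size N nu T k : T \in chains N nu -> size (T k) <= k.
Proof.
case/chainsP => T0 Ts _; elim: k => [|k IH]; first by rewrite T0.
exact: hstrip_size (Ts k) IH.
Qed.

Lemma chain_mono N nu T r k l : T \in chains N nu -> k <= l -> (T k)._[r] <= (T l)._[r].
Proof.
case/chainsP => _ Ts _ /subnK <-; elim: (l - k) => // d IH.
by apply: leq_trans IH _; rewrite addSn; case/hstripP/(_ r): (Ts (d + k)).
Qed.

Lemma chain_sub N nu T r k : T \in chains N nu -> (T k)._[r] <= nu._[r].
Proof.
move=> Tin; have /chainsP[_ _ Te] := Tin.
by rewrite -(Te (maxn k N)) ?leq_maxr //; apply: chain_mono Tin _; apply: leq_maxl.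
Qed.

Lemma chain_size_le N nu T k : T \in chains N nu -> size (T k) <= N.
Proof.
move=> Tin; rewrite leqNgt -intpart_gt0 -leqNgt; apply: leq_trans (chain_sub _ _ Tin) _.
by have /chainsP[_ _ Te] := Tin; rewrite -(Te N) // part_eq0 // (chain_size _ Tin).
Qed.

Lemma chains_size N nu T : T \in chains N nu -> size nu <= N.
Proof. by move=> Tin; have /chainsP[_ _ Te] := Tin; rewrite -(Te N) // (chain_size _ Tin). Qed.

Definition wt T i := psize (T i.+1) - psize (T i).

Lemma chain_psize N nu T k : T \in chains N nu -> psize (T k) = \sum_(i < k) wt T i.
Proof.
case/chainsP => T0 Ts _; elim: k => [|k IH]; first by rewrite T0 big_ord0.
by rewrite big_ord_recr /= -IH /wt subnKC // hstrip_psize.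
Qed.

Lemma chain_wt_ge N nu T i : T \in chains N nu -> N <= i -> wt T i = 0.
Proof. by case/chainsP => _ _ Te Ni; rewrite /wt !Te ?subnn //; apply: leqW. Qed.

Lemma chain_wt_sum N nu T : T \in chains N nu -> \sum_(i < N) wt T i = psize nu.
Proof. by move=> Tin; rewrite -(chain_psize N Tin); case/chainsP: Tin => _ _ ->. Qed.

End Chains.

Section SchurEval.
Local Open Scope ring_scope.
Variable R : comNzRingType.
Implicit Types (x : nat -> R) (nu ka : intpart).

Definition mon x N (w : nat -> nat) : R := \prod_(i < N) x i ^+ w i.

Definition schur_eval x N nu : R := \sum_(T <- chains N nu) mon x N (wt T).

Lemma schur_eval_rec x N nu B : (psize nu <= B)%N ->
  schur_eval x N.+1 nu =
  \sum_(ka <- small_parts B | hstrip nu ka) x N ^+ (psize nu - psize ka) * schur_eval x N ka.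
Proof.
move=> le; rewrite /schur_eval /chains big_paths big_filter.
rewrite (@big_small_parts _ _ _ _ (hstrip nu) B) => [|la]; last first.
  by case: (boolP (hstrip nu la)) => //= /hstrip_psize h; rewrite h (leq_trans h).
apply: eq_bigr => ka _; rewrite big_distrr /= big_seq [RHS]big_seq.
apply: eq_bigr => T /chainsP[_ _ Te].
rewrite /mon big_ord_recr /= mulrC /wt /extend leqnn ltnn Te //; congr (_ * _).
by apply: eq_bigr => i _; rewrite (ltn_ord i) (ltnW (ltn_ord i)).
Qed.

Lemma schur_eval_size x N nu : (N < size nu)%N -> schur_eval x N nu = 0.
Proof.
move=> lt; rewrite /schur_eval big_seq big1 // => T /chains_size; lia.
Qed.

Lemma schur_eval0 x nu : schur_eval x 0 nu = (nu == part0)%:R.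
Proof.
rewrite /schur_eval /=; case: eqP => _; last by rewrite big_nil.
by rewrite big_seq1 /mon big_ord0.
Qed.

End SchurEval.

(** * Bender-Knuth involutions *)

Section Toggle.
Local Open Scope nat_scope.
Implicit Types (la mu nu ka : intpart) (T : nat -> intpart).

Section OneRow.
Variables (j : nat) (nu mu ka : intpart).

(** The upper bound that [ka] imposes on row [r] of [mu]; the value [nu._[0]] for [r = 0] lets the
    first row obey the same formulas as the others. *)
Definition row_above r := if r is r'.+1 then ka._[r'] else nu._[0].

(* The Bender-Knuth involution on Gelfand-Tsetlin patterns, restricted to the
   columns < j: it reflects mu_r in the interval allowed by the rows nu and ka. *)
Definition toggle_row r :=
  if j < mu._[r] then mu._[r]
  else minn (minn nu._[r] (row_above r)) j + maxn nu._[r.+1] ka._[r] - mu._[r].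

Definition toggle_part := part_of (size nu) toggle_row.

Hypotheses (hnm : hstrip nu mu) (hmk : hstrip mu ka) (hcol : forall r, j < mu._[r] -> j < ka._[r]).

Let le_mn r : mu._[r] <= nu._[r]. Proof. by case/hstripP/(_ r): hnm. Qed.
Let le_nm r : nu._[r.+1] <= mu._[r]. Proof. by case/hstripP/(_ r): hnm. Qed.
Let le_km r : ka._[r] <= mu._[r]. Proof. by case/hstripP/(_ r): hmk. Qed.
Let le_mk r : mu._[r.+1] <= ka._[r]. Proof. by case/hstripP/(_ r): hmk. Qed.

Let le_mu_above r : mu._[r] <= row_above r.
Proof. by case: r => [|r] /=; [exact: le_mn | exact: le_mk]. Qed.

Lemma toggle_row_lb r : maxn nu._[r.+1] ka._[r] <= toggle_row r.
Proof.
rewrite /toggle_row.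
have := le_mn r; have := le_nm r; have := le_km r; have := le_mu_above r.
by case: (ltnP j mu._[r]); lia.
Qed.

Lemma toggle_row_ub r : toggle_row r <= minn nu._[r] (row_above r).
Proof.
rewrite /toggle_row.
have := le_mn r; have := le_nm r; have := le_km r; have := le_mu_above r.
by case: (ltnP j mu._[r]); lia.
Qed.

Lemma toggle_partE r : toggle_part._[r] = toggle_row r.
Proof.
apply: part_ofE => [i|]; last first.
  by have := toggle_row_ub (size nu); rewrite part_eq0 //; lia.
by have := toggle_row_ub i.+1; have := toggle_row_lb i => /=; lia.
Qed.

Lemma toggle_part_hstrip : hstrip nu toggle_part /\ hstrip toggle_part ka.
Proof.
split; apply/hstripP => r; rewrite !toggle_partE.
  by have := toggle_row_lb r; have := toggle_row_ub r; lia.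
by have := toggle_row_lb r; have := toggle_row_ub r.+1 => /=; lia.
Qed.

Lemma toggle_row_gt r : (j < toggle_row r) = (j < mu._[r]).
Proof.
rewrite /toggle_row; have := le_nm r; have := le_km r; case: (ltnP j mu._[r]) => [-> //|*].
by apply/negbTE; rewrite -leqNgt; lia.
Qed.

Lemma toggle_row_high r k : j <= k -> toggle_row r - k = mu._[r] - k.
Proof.
move=> jk; have := toggle_row_gt r; rewrite /toggle_row; case: (ltnP j mu._[r]) => //; lia.
Qed.

(** When [j < mu._[r]] the row is left alone, and [hcol], which says that [mu/ka] has no box in
    column [j], makes both sides equal to [2j]. In the other rows this is the reflection itself. *)
Lemma toggle_row_low r :
  minn (toggle_row r) j + minn mu._[r] j =
  minn (minn nu._[r] j) (row_above r) + maxn (minn nu._[r.+1] j) (minn ka._[r] j).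
Proof.
have := @hcol r; rewrite /toggle_row.
have := le_mn r; have := le_nm r; have := le_km r; have := le_mu_above r.
by case: (ltnP j mu._[r]); lia.
Qed.

Lemma toggle_low N : size nu <= N ->
  \sum_(r < N) minn toggle_part._[r] j + \sum_(r < N) minn mu._[r] j =
  \sum_(r < N) minn nu._[r] j + \sum_(r < N) minn ka._[r] j.
Proof.
(* The maximum from one row and the minimum from the next involve the same two numbers, so together
   they give the sum of the two; the extra terms account for the last, unpaired minimum. *)
have E M : \sum_(r < M) minn toggle_part._[r] j + \sum_(r < M) minn mu._[r] j
    + minn (minn nu._[M] j) (row_above M) =
  \sum_(r < M) minn nu._[r] j + \sum_(r < M) minn ka._[r] j + minn nu._[M] j.
  elim: M => [|M IH]; first by rewrite !big_ord0 /=; lia.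
  rewrite (sum_ordS (fun r => minn toggle_part._[r] j)) (sum_ordS (fun r => minn mu._[r] j)).
  rewrite (sum_ordS (fun r => minn nu._[r] j)) (sum_ordS (fun r => minn ka._[r] j)).
  by rewrite toggle_partE [row_above M.+1]/=; have := toggle_row_low M; lia.
by move=> le; have := E N; rewrite (part_eq0 le); lia.
Qed.

Lemma toggle_high N k : j <= k ->
  \sum_(r < N) (toggle_part._[r] - k) = \sum_(r < N) (mu._[r] - k).
Proof. by move=> jk; apply: eq_bigr => r _; rewrite toggle_partE toggle_row_high. Qed.

End OneRow.

Lemma toggle_partK j nu mu ka :
  hstrip nu mu -> hstrip mu ka -> toggle_part j nu (toggle_part j nu mu ka) ka = mu.
Proof.
move=> h1 h2; have [h1' h2'] := toggle_part_hstrip j h1 h2.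
apply: intpart_eqP => r; rewrite toggle_partE // {1}/toggle_row !toggle_partE // toggle_row_gt //.
have := toggle_row_lb j h1 h2 r; have := toggle_row_ub j h1 h2 r.
rewrite /toggle_row; move/hstripP/(_ r): (h1); move/hstripP/(_ r): (h2).
have : mu._[r] <= row_above nu ka r.
  by case: r => [|r] /=; [case/hstripP/(_ 0): h1 | case/hstripP/(_ r): h2].
by case: (ltnP j mu._[r]); lia.
Qed.

Definition toggle j i T : nat -> intpart :=
  fun k => if k == i.+1 then toggle_part j (T i.+2) (T i.+1) (T i) else T k.

Lemma toggle_neq j i T k : k != i.+1 -> toggle j i T k = T k.
Proof. by rewrite /toggle => /negbTE ->. Qed.

(** Counts the boxes of [T k] in the columns [>= j]; [low_size] counts those in the columns
    [< j]. *)
Definition high_size N T j k := \sum_(r < N) ((T k)._[r] - j).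
Definition low_size N T j k := \sum_(r < N) minn (T k)._[r] j.

Section OneChain.
Variables (N : nat) (be : intpart) (j i : nat) (T : nat -> intpart).
Hypotheses (Tin : T \in chains N be).

Let Ths k : hstrip (T k.+1) (T k). Proof. by case/chainsP: Tin. Qed.

Lemma toggle_chain : i.+1 < N -> toggle j i T \in chains N be.
Proof.
move=> iN; have [h1 h2] := toggle_part_hstrip j (Ths i.+1) (Ths i).
case/chainsP: Tin => T0 _ Te; apply/chainsP; rewrite /toggle; split=> [//|k|k Nk].
  rewrite eqSS; case: (eqVneq k i) => [->|ne].
    by rewrite ltn_eqF.
  by case: (eqVneq k i.+1) => [->|//].
by rewrite gtn_eqF ?(leq_trans iN) // Te.
Qed.

Lemma toggleK : toggle j i (toggle j i T) = T.
Proof.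
apply: funext => k; rewrite {1}/toggle; case: eqP => [->|/eqP/negbTE ne]; last by rewrite /toggle ne.
by rewrite /toggle eqxx (gtn_eqF (ltnSn i.+1)) (ltn_eqF (ltnSn i)) toggle_partK.
Qed.

Lemma toggle_high_size j' k : j <= j' -> high_size N (toggle j i T) j' k = high_size N T j' k.
Proof. by rewrite /high_size /toggle => le; case: eqP => [->|//]; apply: toggle_high. Qed.

Lemma psize_low_high k : psize (T k) = low_size N T j k + high_size N T j k.
Proof.
rewrite (psizeE (chain_size_le k Tin)) -big_split /=.
by apply: eq_bigr => r _; lia.
Qed.

End OneChain.

(** The columns [>= j] are untouched, and in the columns [< j] the numbers of entries [i] and [i.+1]
    are exchanged. *)
Lemma toggle_psize N be j i T : T \in chains N be -> i.+1 < N ->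
  (forall r, j < (T i.+1)._[r] -> j < (T i)._[r]) ->
  psize (toggle j i T i.+1) + low_size N T j i.+1 =
  low_size N T j i.+2 + low_size N T j i + high_size N T j i.+1.
Proof.
move=> Tin iN hcol; rewrite (psize_low_high j (toggle_chain j Tin iN)).
rewrite (toggle_high_size _ Tin) // addnAC; congr addn.
have Ths k : hstrip (T k.+1) (T k) by case/chainsP: Tin.
rewrite /low_size /toggle eqxx; apply: toggle_low => //.
exact: chain_size_le Tin.
Qed.

End Toggle.

(** * Symmetry of Schur polynomials *)

Section Symmetry.
Local Open Scope ring_scope.
Variables (R : comNzRingType) (N : nat) (be : intpart).

Lemma wt_toggle_neq j i T k : k != i -> k != i.+1 -> wt (toggle j i T) k = wt T k.
Proof. by move=> h1 h2; rewrite /wt !toggle_neq. Qed.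

Definition schur_ord (x : 'I_N -> R) : R :=
  \sum_(T <- chains N be) \prod_(i < N) x i ^+ wt T i.

(** No row is longer than [psize be], so toggling with that value of [j] acts on all columns: it is
    the full Bender-Knuth involution, and it exchanges the two weights. *)
Lemma schur_ord_adjacent (x : 'I_N -> R) (i i' : 'I_N) : i' = i.+1 :> nat ->
  schur_ord (x \o tperm i i') = schur_ord x.
Proof.
move=> ii'; have iN : (i.+1 < N)%N by rewrite -ii'.
rewrite /schur_ord [RHS](@big_involution _ _ _ xpredT (toggle (psize be) i)); first last.
- by move=> T Tin _; rewrite toggle_chain // (toggleK _ _ Tin).
- exact: chains_uniq.
rewrite big_seq [RHS]big_seq; apply: eq_bigr => T Tin.
rewrite (reindex_inj (@perm_inj _ (tperm i i'))) /=; apply: eq_bigr => k _.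
rewrite tpermK; congr (_ ^+ _).
have /chainsP[_ Ts _] := Tin.
have leT k0 r : ((T k0)._[r] <= psize be)%N.
  by apply: leq_trans (chain_sub _ _ Tin) _; apply: part_le_psize.
have hcol r : (psize be < (T i.+1)._[r])%N -> (psize be < (T i)._[r])%N.
  by have := leT i.+1 r; lia.
have := toggle_psize Tin iN hcol.
have low k0 : low_size N T (psize be) k0 = psize (T k0).
  by rewrite (psizeE (chain_size_le k0 Tin)); apply: eq_bigr => r _; apply/minn_idPl.
have high k0 : high_size N T (psize be) k0 = 0%N.
  by apply: big1 => r _; apply/eqP; rewrite subn_eq0.
rewrite !low high => E; have := hstrip_psize (Ts i); have := hstrip_psize (Ts i.+1).
case: tpermP => [->|->|/eqP h1 /eqP h2]; rewrite ?ii'.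
- by rewrite /wt (@toggle_neq _ _ _ i) ?ltn_eqF //; lia.
- by rewrite /wt (@toggle_neq _ _ _ i.+2) ?gtn_eqF //; lia.
- by rewrite wt_toggle_neq // -ii'.
Qed.

Lemma schur_ord_perm (x : 'I_N -> R) (s : 'S_N) : schur_ord (x \o s) = schur_ord x.
Proof.
have mulP (s1 s2 : 'S_N) : (forall x, schur_ord (x \o s1) = schur_ord x) ->
    (forall x, schur_ord (x \o s2) = schur_ord x) ->
    forall x, schur_ord (x \o (s1 * s2)%g) = schur_ord x.
  move=> h1 h2 y; rewrite -[RHS]h2 -[RHS]h1; congr schur_ord.
  by apply: funext => k /=; rewrite permM.
have tpermP d (i k : 'I_N) : k = (i + d).+1 :> nat -> forall x, schur_ord (x \o tperm i k) = schur_ord x.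
  elim: d i k => [|d IH] i k ik y.
    by apply: schur_ord_adjacent; rewrite ik addn0.
  have kN : (i + d.+1 < N)%N by rewrite (leq_trans _ (ltn_ord k)) // ik.
  pose l := Ordinal kN.
  have il : i != l by rewrite -val_eqE /= ltn_eqF //; lia.
  have ik' : i != k by rewrite -val_eqE /= ltn_eqF //; lia.
  (* Conjugation by an adjacent transposition brings the two indices one step closer. *)
  have -> : tperm i k = (tperm l k * (tperm i l * tperm l k))%g.
    have := tpermJ i l (tperm l k); rewrite tpermL tpermD 1?eq_sym // => <-.
    by rewrite conjgE tpermV.
  have adj z : schur_ord (z \o tperm l k) = schur_ord z.
    by apply: schur_ord_adjacent; rewrite ik.
  by do 2![apply: (mulP) => //]; apply: IH; rewrite /= addnS.
have [ts -> _] := prod_tpermP s; elim: ts x => [|[i k] ts IH] x.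
  rewrite big_nil; congr schur_ord; apply: funext => k /=; by rewrite perm1.
rewrite big_cons; apply: (mulP) => // {}x /=.
case: (ltngtP i k) => [ik|ki|/ord_inj->].
- by apply: (tpermP (k - i.+1)%N); lia.
- by rewrite tpermC; apply: (tpermP (i - k.+1)%N); lia.
- rewrite tperm1; congr schur_ord; apply: funext => l /=; by rewrite perm1.
Qed.

End Symmetry.

(** * Alternants and their products with Schur polynomials *)

Section Alternants.
Local Open Scope ring_scope.
Variables (R : comNzRingType) (x : nat -> R) (N : nat).

Definition alternant (al : nat -> nat) : R := \det (\matrix_(i < N, j < N) x j ^+ al i).

Lemma alternant_ext al al' : (forall i, (i < N)%N -> al i = al' i) -> alternant al = alternant al'.
Proof. by move=> h; congr (\det _); apply/matrixP => i j; rewrite !mxE h. Qed.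

(** In the term of the determinant for a permutation [s], symmetry allows the variables of the Schur
    polynomial to be permuted by [s] too; the weight of [T] then adds to the exponents row by
    row. *)
Lemma alternant_mul_schur al be :
  alternant al * schur_eval x N be = \sum_(T <- chains N be) alternant (fun i => al i + wt T i)%N.
Proof.
rewrite /alternant /determinant big_distrl /= exchange_big /=; apply: eq_bigr => s _.
rewrite -mulrA -big_distrr /=; congr (_ * _).
rewrite -[schur_eval _ _ _]/(schur_ord be (fun i : 'I_N => x i)) -(schur_ord_perm _ _ s).
rewrite /schur_ord big_distrr /=; apply: eq_bigr => T _.
by rewrite -big_split /=; apply: eq_bigr => i _; rewrite !mxE exprD.
Qed.

Lemma alternant_swap al al' i : (i.+1 < N)%N -> al' i = al i.+1 -> al' i.+1 = al i ->
  (forall k, k != i -> k != i.+1 -> al' k = al k) -> alternant al' = - alternant al.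
Proof.
move=> iN h1 h2 h; pose i0 := Ordinal (ltnW iN); pose i1 := Ordinal iN.
have ne : i0 != i1 by rewrite -val_eqE /= ltn_eqF.
have -> : alternant al' = \det (xrow i0 i1 (\matrix_(i < N, j < N) x j ^+ al i)).
  congr (\det _); apply/matrixP => k l; rewrite !mxE; congr (_ ^+ _).
  by case: tpermP => [->|->|/eqP k0 /eqP k1] //=; apply: h.
by rewrite xrowE det_mulmx det_perm odd_tperm ne expr1 mulN1r.
Qed.

End Alternants.

(** * The Littlewood-Richardson rule *)

Section Good.
Local Open Scope nat_scope.
Implicit Types (la be : intpart) (T : nat -> intpart).

(* For a chain read as a tableau, the number of entries i in the columns >= j. *)
Definition high_wt N T j i := high_size N T j i.+1 - high_size N T j i.

Definition dominant_at N la T j i := la._[i.+1] + high_wt N T j i.+1 <= la._[i] + high_wt N T j i.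

Definition dominant_from N la J j T :=
  all (fun j' => all (dominant_at N la T j') (iota 0 N)) (iota j (J - j)).

(** Stembridge's condition, that [la] plus the weight of the columns [>= j] is a partition for every
    [j], tested on the finite range of [j] and [i] where it can fail. *)
Definition good N la be T := dominant_from N la (psize be) 0 T.

Variables (N : nat) (be la : intpart) (T : nat -> intpart).
Definition col_size j k := \sum_(r < N) (j < (T k)._[r]).

Lemma high_size_col j k : high_size N T j k = high_size N T j.+1 k + col_size j k.
Proof. by rewrite -big_split /=; apply: eq_bigr => r _; case: ltnP; lia. Qed.

Hypothesis Tin : T \in chains N be.

Let Ths k : hstrip (T k.+1) (T k). Proof. by case/chainsP: Tin. Qed.

Lemma high_size_mono j k l : k <= l -> high_size N T j k <= high_size N T j l.
Proof. by move=> kl; apply: leq_sum => r _; apply: leq_sub2r; apply: chain_mono Tin kl. Qed.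

Lemma high_size0 j k : psize be <= j -> high_size N T j k = 0.
Proof.
move=> le; apply: big1 => r _; apply/eqP; rewrite subn_eq0.
by apply: leq_trans (chain_sub _ _ Tin) (leq_trans (part_le_psize _ _) le).
Qed.

Lemma high_wt_ge j i : N <= i -> high_wt N T j i = 0.
Proof. by case/chainsP: Tin => _ _ Te Ni; rewrite /high_wt /high_size !Te ?subnn //; apply: leqW. Qed.

Lemma dominant_at_ge_col j i : psize be <= j -> dominant_at N la T j i.
Proof. by move=> le; rewrite /dominant_at /high_wt !high_size0 // !addn0 part_anti. Qed.

Lemma col_size_mono j k : col_size j k <= col_size j k.+1.
Proof.
by apply: leq_sum => r _; have /hstripP/(_ r) [h _] := Ths k; case: ltnP => // lt; rewrite (leq_trans lt h).
Qed.

(* A horizontal strip has at most one box in column j. *)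
Lemma col_size_step j k : col_size j k.+1 <= (col_size j k).+1.
Proof.
rewrite /col_size; have E M : \sum_(r < M.+1) (j < (T k.+1)._[r]) <= (\sum_(r < M) (j < (T k)._[r])).+1.
  elim: M => [|M IH]; first by rewrite big_ord_recl !big_ord0 addn0; case: ltnP.
  rewrite (sum_ordS (fun r => nat_of_bool (j < (T k.+1)._[r]))).
  rewrite (sum_ordS (fun r => nat_of_bool (j < (T k)._[r]))).
  have /hstripP/(_ M) [_ h] := Ths k.
  suff : nat_of_bool (j < (T k.+1)._[M.+1]) <= nat_of_bool (j < (T k)._[M]) by lia.
  by case: (ltnP j (T k.+1)._[M.+1]) => // lt; rewrite (leq_trans lt h).
by apply: leq_trans (E N); rewrite (sum_ordS (fun r => nat_of_bool (j < (T k.+1)._[r]))) leq_addr.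
Qed.

Lemma col_size_eq j k r : col_size j k.+1 = col_size j k ->
  j < (T k.+1)._[r] -> j < (T k)._[r].
Proof.
move=> E lt; case: (ltnP r N) => [rN|rN]; last first.
  by move: lt; rewrite part_eq0 ?(leq_trans (chain_size_le _ Tin)).
case: (ltnP j (T k)._[r]) => // le0.
have le : (j < (T k)._[r]) = false by rewrite ltnNge le0.
suff : col_size j k < col_size j k.+1 by rewrite E ltnn.
rewrite /col_size (bigD1 (Ordinal rN)) //= [X in _ < X](bigD1 (Ordinal rN)) //= lt le /=.
rewrite add0n add1n ltnS; apply: leq_sum => r' _; have /hstripP/(_ r') [h _] := Ths k.
by case: (ltnP j (T k)._[r']) => // lt'; rewrite (leq_trans lt' h).
Qed.

Hypothesis size_la : size la <= N.

Lemma dominant_at_ge_row j i : N <= i.+1 -> dominant_at N la T j i.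
Proof. by move=> le; rewrite /dominant_at high_wt_ge // part_eq0 // (leq_trans size_la). Qed.

Lemma dominant_fromP j0 :
  reflect (forall j i, j0 <= j -> dominant_at N la T j i) (dominant_from N la (psize be) j0 T).
Proof.
apply: (iffP allP) => [h j i le|h j]; last first.
  by rewrite mem_iota => /andP[le _]; apply/allP => i _; apply: h.
case: (leqP (psize be) j) => [|lt]; first exact: dominant_at_ge_col.
case: (leqP N i) => [|ltN]; first by move/leqW/dominant_at_ge_row.
by have /allP -> := h j ltac:(rewrite mem_iota; lia); rewrite // mem_iota.
Qed.

Lemma goodP : reflect (forall j i, dominant_at N la T j i) (good N la be T).
Proof. by apply: (iffP (dominant_fromP 0)) => h j i; [apply: h | move=> _; apply: h]. Qed.

End Good.

Section Cancellation.
Local Open Scope nat_scope.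
Variables (N : nat) (be la : intpart) (T : nat -> intpart) (i j : nat).
Hypotheses (Tin : T \in chains N be) (iN : i.+1 < N).
Hypotheses (dom : dominant_at N la T j.+1 i) (ndom : ~~ dominant_at N la T j i).

Let Ths k : hstrip (T k.+1) (T k). Proof. by case/chainsP: Tin. Qed.

(** A column has at most one entry [i] and one entry [i.+1]. So including column [j] can break the
    inequality only by 1, and only if that column contains an [i.+1] and no [i]. *)
Lemma first_defect :
  (forall r, j < (T i.+1)._[r] -> j < (T i)._[r]) /\
  la._[i.+1] + high_wt N T j i.+1 = (la._[i] + high_wt N T j i).+1.
Proof.
have hm k := high_size_mono Tin j (leqnSn k).
have hm' k := high_size_mono Tin j.+1 (leqnSn k).
have hc k := high_size_col N T j k.
have cm k := col_size_mono Tin j k; have cs k := col_size_step Tin j k.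
move: dom ndom; rewrite /dominant_at /high_wt -ltnNge.
have := (hm i, hm i.+1, hm' i, hm' i.+1, hc i, hc i.+1, hc i.+2).
move: (cm i) (cs i) (cm i.+1) (cs i.+1) => c1 c2 c3 c4 [[[[[[h1 h2] h3] h4] h5] h6] h7] d1 d2.
split=> [r|]; last by lia.
by apply: (col_size_eq Tin); lia.
Qed.

(** The excess of exactly 1 offsets the drop of the staircase from [i] to [i.+1]. Hence [la], the
    staircase and the columns [>= j] contribute equally at both places, and the toggle exchanges
    what the columns [< j] contribute. *)
Lemma toggle_weight_swap :
  let al T k := la._[k] + wt T k + (N.-1 - k) in
  al (toggle j i T) i = al T i.+1 /\ al (toggle j i T) i.+1 = al T i.
Proof.
have [hcol E] := first_defect.
have := toggle_psize Tin iN hcol.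
have := hstrip_psize (Ths i); have := hstrip_psize (Ths i.+1).
have [p1 _] := toggle_part_hstrip j (Ths i.+1) (Ths i); move/hstrip_psize: p1.
have /chainsP[_ /(_ i) /hstrip_psize + _] := toggle_chain j Tin iN.
rewrite {1 3}/toggle eqxx ltn_eqF //.
have lh k := psize_low_high j Tin k.
have := high_size_mono Tin j (leqnSn i); have := high_size_mono Tin j (leqnSn i.+1).
move: E (lh i) (lh i.+1) (lh i.+2).
rewrite /= /wt /high_wt (@toggle_neq j i T i) ?ltn_eqF // (@toggle_neq j i T i.+2) ?gtn_eqF //.
rewrite /toggle eqxx; lia.
Qed.

End Cancellation.

Section Stembridge.
Local Open Scope ring_scope.
Variables (R : idomainType) (x : nat -> R) (N : nat).
Hypothesis two_neq0 : 2%:R != 0 :> R.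

Definition stair i := (N.-1 - i)%N.

Let alt la T := alternant x N (fun k => la._[k] + wt T k + stair k)%N.

(** The toggle preserves the columns [>= j], hence all three conditions on [T], while it swaps two
    exponents of the alternant. It permutes the index set and changes every sign. *)
Lemma defect_sum0 (la be : intpart) i j : (size la <= N)%N -> (i.+1 < N)%N ->
  \sum_(T <- chains N be | [&& dominant_from N la (psize be) j.+1 T,
      all (dominant_at N la T j) (iota 0 i) & ~~ dominant_at N la T j i]) alt la T = 0.
Proof.
move=> size_la iN; set Q := BIG_P; set S := bigop _ _ _.
suff : S = - S.
  move/eqP; rewrite -subr_eq0 opprK -mulr2n -mulr_natr mulf_eq0 (negbTE two_neq0) orbF.
  by move/eqP.
rewrite {1}/S (@big_involution _ _ _ _ (toggle j i)) ?chains_uniq //; last first.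
  move=> T Tin /and3P[d1 d2 d3]; rewrite (toggleK _ _ Tin) toggle_chain //; split=> //.
  have Tin' := toggle_chain j Tin iN.
  have E j' k : (j <= j')%N -> dominant_at N la (toggle j i T) j' k = dominant_at N la T j' k.
    by move=> le; rewrite /dominant_at /high_wt !(toggle_high_size _ Tin).
  apply/and3P; split; last by rewrite E.
    apply/(dominant_fromP Tin' size_la) => j' k le; rewrite E ?(ltnW le) //.
    by move/(dominant_fromP Tin size_la): d1; apply.
  by apply/allP => k kin; rewrite E //; move/allP: d2; apply.
rewrite /S -sumrN big_seq_cond [RHS]big_seq_cond; apply: eq_bigr => T /andP[Tin /and3P[d1 _ d3]].
have d2 : dominant_at N la T j.+1 i by move/(dominant_fromP Tin size_la): d1; apply.
have [s1 s2] := toggle_weight_swap Tin iN d2 d3.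
by apply: (alternant_swap _ iN) => // k k1 k2; rewrite wt_toggle_neq.
Qed.

(** Bad tableaux are sorted by their first failure, scanning the columns from right to left and,
    within a column, the index [i] upwards; each class sums to 0 by [defect_sum0]. *)
Lemma good_sum (la be : intpart) : (size la <= N)%N ->
  \sum_(T <- chains N be) alt la T = \sum_(T <- chains N be | good N la be T) alt la T.
Proof.
move=> size_la.
suff H j : (j <= psize be)%N ->
    \sum_(T <- chains N be) alt la T =
    \sum_(T <- chains N be | dominant_from N la (psize be) (psize be - j) T) alt la T.
  by rewrite [LHS](H (psize be)) // subnn.
elim: j => [|j IH] le.
  by rewrite /dominant_from subn0 subnn /=; apply: eq_bigl.
rewrite (IH (ltnW le)); set j0 := (psize be - j.+1)%N.
have -> : (psize be - j)%N = j0.+1 by rewrite /j0; lia.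
have step i : (i <= N)%N ->
   \sum_(T <- chains N be | dominant_from N la (psize be) j0.+1 T) alt la T =
   \sum_(T <- chains N be | dominant_from N la (psize be) j0.+1 T && all (dominant_at N la T j0) (iota 0 i)) alt la T.
  elim: i => [|i IHi] iN; first by apply: eq_bigl => T; rewrite andbT.
  rewrite (IHi (ltnW iN)) (bigID (fun T => dominant_at N la T j0 i)) [LHS]/= addrC.
  rewrite (_ : \sum_(_ <- _ | _ && ~~ _) _ = 0) ?add0r.
    by apply: eq_bigl => T; rewrite -[i.+1]addn1 iotaD all_cat [all _ (iota _ 1)]/= andbT -andbA add0n.
  case: (ltnP i.+1 N) => [iN'|Ni].
    by rewrite -[RHS](defect_sum0 be j0 size_la iN'); apply: eq_bigl => T; rewrite andbA.
  rewrite big_seq_cond big1 // => T /and3P[Tin _].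
  by rewrite (dominant_at_ge_row Tin).
rewrite (step N) //; apply: eq_bigl => T.
rewrite /dominant_from (_ : psize be - j0 = (psize be - j0.+1).+1)%N /=; last by rewrite /j0; lia.
by rewrite andbC.
Qed.

End Stembridge.

(** * The only good tableau for the empty partition *)

Section Superstandard.
Local Open Scope nat_scope.
Implicit Types (la be : intpart) (T : nat -> intpart).

(** Keeping the first [k] rows at stage [k] encodes the tableau whose row [r] is filled with [r]. *)
Definition superstandard be k := part_of k (fun r => if r < k then be._[r] else 0).

Lemma superstandardE be k r : (superstandard be k)._[r] = if r < k then be._[r] else 0.
Proof.
rewrite part_ofE ?ltnn // => i; case: (ltnP i.+1 k) => // ik; rewrite (ltnW ik).
exact: part_anti.
Qed.

Lemma superstandard_chain N be : size be <= N -> superstandard be \in chains N be.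
Proof.
move=> le; apply/chainsP; split=> [|k|k Nk].
- by apply: intpart_eqP => r; rewrite superstandardE.
- apply/hstripP => r; rewrite !superstandardE; have := part_anti be (leqnSn r).
  by case: (ltnP r k); case: (ltnP r k.+1); case: (ltnP r.+1 k.+1); lia.
- apply: intpart_eqP => r; rewrite superstandardE; case: ltnP => // kr.
  by rewrite part_eq0 // (leq_trans le) // (leq_trans Nk).
Qed.

Lemma superstandard_wt N be k : size be <= N -> wt (superstandard be) k = be._[k].
Proof.
move=> le; pose M := maxn N k.+1.
have sz l : l <= k.+1 -> size (superstandard be l) <= k.+1.
  by move=> h; apply: leq_trans h; apply: chain_size (superstandard_chain le).
rewrite /wt (psizeE (sz k.+1 _)) // (psizeE (sz k _)) //.
rewrite !(sum_ordS (fun r => (superstandard be _)._[r])) !superstandardE ltnn ltnSn.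
have -> : \sum_(i < k) (superstandard be k.+1)._[i] = \sum_(i < k) (superstandard be k)._[i].
  by apply: eq_bigr => i _; rewrite !superstandardE ltn_ord ltnW // ltnS ltn_ord.
by rewrite addn0 addKn.
Qed.

Lemma superstandard_high_wt N be j k : size be <= N ->
  high_wt N (superstandard be) j k = be._[k] - j.
Proof.
move=> le; rewrite /high_wt /high_size.
case: (ltnP k N) => [kN|Nk]; last first.
  rewrite part_eq0 ?(leq_trans le) // sub0n; apply/eqP; rewrite subn_eq0.
  by apply: leq_sum => r _; rewrite !superstandardE !(leq_trans (ltn_ord r)) // ltnW.
rewrite (bigD1 (Ordinal kN)) //= [X in _ - X](bigD1 (Ordinal kN)) //= !superstandardE ltnn ltnSn sub0n add0n.
rewrite -[X in _ - X]add0n (_ : \sum_(i < N | _) _ = \sum_(i < N | i != Ordinal kN) ((superstandard be k)._[i] - j)).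
  by rewrite subnDr subn0.
apply: eq_bigr => i /eqP ne; rewrite !superstandardE ltnS leq_eqVlt.
by case: eqP => // e; case: ne; apply: ord_inj.
Qed.

Lemma good_superstandard N be : size be <= N -> good N part0 be (superstandard be).
Proof.
move=> le; apply/(@goodP _ _ part0 _ (superstandard_chain le) (leq0n N)) => j i.
by rewrite /dominant_at !(superstandard_high_wt _ _ le) !part0E !add0n leq_sub2r // part_anti.
Qed.

(* If row r is the first row with an entry other than r, its last entry i > r
   lies in a column j such that the columns >= j contain an i but no i-1. *)
Lemma good_part0 N be T : T \in chains N be -> good N part0 be T -> T = superstandard be.
Proof.
move=> Tin /(@goodP _ _ part0 _ Tin (leq0n N)) dom.
have {}dom j i : high_wt N T j i.+1 <= high_wt N T j i.
  by have := dom j i; rewrite /dominant_at !part0E.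
have szbe := chains_size Tin.
have row r k : r < k -> (T k)._[r] = be._[r].
  elim/ltn_ind: r k => r IH k rk.
  case: (ltnP (T k)._[r] be._[r]) => [lt|ge]; last first.
    by apply/eqP; rewrite eqn_leq ge (chain_sub _ _ Tin).
  have [i [ri lti eqi]] : exists i, [/\ r < i, (T i)._[r] < be._[r] & (T i.+1)._[r] = be._[r]].
    have ex : exists i, (r < i) && ((T i)._[r] < be._[r]) by exists k; rewrite rk lt.
    have ub i : (r < i) && ((T i)._[r] < be._[r]) -> i <= N.
      case/andP=> _ h; case: (leqP i N) => // Ni.
      by have /chainsP[_ _ Te] := Tin; rewrite (Te _ (ltnW Ni)) ltnn in h.
    case: (ex_maxnP ex ub) => i /andP[ri lti] mx; exists i; split=> //.
    apply/eqP; rewrite eqn_leq (chain_sub _ _ Tin) leqNgt; apply/negP => h.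
    by have := mx i.+1; rewrite h (leqW ri) ltnn => /(_ isT).
  have rN : r < N.
    by rewrite ltnNge; apply/negP => Nr; rewrite (@part_eq0 be) ?(leq_trans szbe) in lti.
  pose j := be._[r].-1.
  have h1 : 0 < high_wt N T j i.
    rewrite /high_wt subn_gt0 /high_size (bigD1 (Ordinal rN)) //= [X in _ < X](bigD1 (Ordinal rN)) //=.
    rewrite eqi -addSn leq_add //; first by rewrite /j; lia.
    by apply: leq_sum => r' _; apply: leq_sub2r; apply: chain_mono Tin _.
  (* Rows above [r] are already complete in [T i.-1] by induction, and from row [r] on [T i] does
     not reach column [j]; so no entry [i.-1] occurs in the columns [>= j]. *)
  have h0 : high_wt N T j i.-1 = 0.
    rewrite /high_wt (prednK (leq_ltn_trans (leq0n r) ri)); apply/eqP; rewrite subn_eq0.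
    apply: leq_sum => r' _; case: (ltnP r' r) => [lt'|le'].
      by rewrite !IH //; lia.
    rewrite (_ : (T i)._[r'] - j = 0) //; apply/eqP; rewrite subn_eq0.
    by apply: leq_trans (part_anti _ le') _; rewrite /j; lia.
  by have := dom j i.-1; rewrite (prednK (leq_ltn_trans (leq0n r) ri)) h0; lia.
apply: funext => k; apply: intpart_eqP => r; rewrite superstandardE.
by case: ltnP => [/row //|kr]; rewrite part_eq0 // (leq_trans (chain_size _ Tin)).
Qed.

End Superstandard.

Section LRRule.
Local Open Scope ring_scope.
Variables (R : idomainType) (x : nat -> R) (N : nat).
Hypothesis two_neq0 : 2%:R != 0 :> R.
Hypothesis x_inj : injective x.
Implicit Types la be : intpart.

Lemma alternant_stair_neq0 : alternant x N (stair N) != 0.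
Proof.
have -> : alternant x N (stair N) =
    \det (row_perm (perm (@rev_ord_inj N)) (Vandermonde N (\row_(j < N) x j))).
  congr (\det _); apply/matrixP => i j; rewrite !mxE permE /= /stair; congr (_ ^+ _).
  by case: N i j => [[]|n i j] //=; rewrite subSS.
rewrite row_permE det_mulmx det_perm det_Vandermonde mulf_neq0 ?signr_eq0 //.
apply/prodf_neq0 => i _; apply/prodf_neq0 => j ij.
rewrite !mxE subr_eq0; apply/eqP => /x_inj/ord_inj e.
by rewrite e ltnn in ij.
Qed.

(** Jacobi's bialternant formula: [good_sum] for the empty partition, where only the superstandard
    tableau survives. *)
Lemma alternant_schur be : (size be <= N)%N ->
  alternant x N (stair N) * schur_eval x N be = alternant x N (fun i => be._[i] + stair N i)%N.
Proof.
move=> le; rewrite alternant_mul_schur.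
have E T : alternant x N (fun i => stair N i + wt T i)%N =
           alternant x N (fun i => part0._[i] + wt T i + stair N i)%N.
  by apply: alternant_ext => i _; rewrite part0E addnC.
rewrite (eq_bigr _ (fun T _ => E T)) good_sum // -big_filter.
rewrite (_ : filter _ _ = [:: superstandard be]).
  by rewrite big_seq1; apply: alternant_ext => i _; rewrite part0E (superstandard_wt _ le).
apply/perm_small_eq => //; apply: uniq_perm => [||T] //; first exact/filter_uniq/chains_uniq.
rewrite mem_filter inE; apply/andP/eqP => [[g Tin]|->]; first exact: good_part0 Tin g.
by split; [apply: good_superstandard | apply: superstandard_chain].
Qed.

Definition add_wt la T : intpart := part_of N (fun i => la._[i] + wt T i)%N.

Lemma add_wtE la be T i : (size la <= N)%N -> T \in chains N be -> good N la be T ->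
  (add_wt la T)._[i] = (la._[i] + wt T i)%N.
Proof.
move=> size_la Tin /(goodP Tin size_la) dom; apply: part_ofE; last first.
  by rewrite part_eq0 // (chain_wt_ge Tin).
move=> k; have := dom 0%N k; rewrite /dominant_at.
have E l : high_wt N T 0 l = wt T l.
  rewrite /high_wt /wt /high_size !(psizeE (chain_size_le _ Tin)).
  by congr subn; apply: eq_bigr => r _; rewrite subn0.
by rewrite !E.
Qed.

(** After multiplication by the Vandermonde alternant, the bialternant formula turns [la] into an
    alternant, the product with [be] is expanded and cancelled down to good tableaux, and the same
    formula read backwards gives the right-hand side. *)
Lemma schur_mul la be : (size la <= N)%N ->
  schur_eval x N be * schur_eval x N la =
  \sum_(T <- chains N be | good N la be T) schur_eval x N (add_wt la T).
Proof.
move=> le; apply: (mulfI alternant_stair_neq0).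
rewrite mulrCA alternant_schur // mulrC alternant_mul_schur big_distrr /=.
have E T : alternant x N (fun i => la._[i] + stair N i + wt T i)%N =
           alternant x N (fun i => la._[i] + wt T i + stair N i)%N.
  by apply: alternant_ext => i _; rewrite addnAC.
rewrite (eq_bigr _ (fun T _ => E T)) good_sum // big_seq_cond [RHS]big_seq_cond.
apply: eq_bigr => T /andP[Tin gT]; rewrite alternant_schur.
  by apply: alternant_ext => i _; rewrite (add_wtE _ _ Tin).
by rewrite leqNgt -intpart_gt0 (add_wtE _ _ Tin) // part_eq0 // (chain_wt_ge Tin).
Qed.

End LRRule.

(** * Pieri's formula *)

Section Rows.
Local Open Scope nat_scope.
Implicit Types (la mu ka : intpart) (T : nat -> intpart).

Definition row_part k := part_of 1 (fun r => if r is 0 then k else 0).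

Lemma row_partE k r : (row_part k)._[r] = if r is 0 then k else 0.
Proof. by rewrite part_ofE // => -[|i]. Qed.

Lemma row_part_size k : size (row_part k) <= 1.
Proof. by rewrite leqNgt -intpart_gt0 row_partE. Qed.

Lemma psize_row_part k : psize (row_part k) = k.
Proof. by rewrite (psizeE (row_part_size k)) big_ord1 row_partE. Qed.

Lemma row_chain_high N k T j l : T \in chains N (row_part k) -> high_size N T j l = (T l)._[0] - j.
Proof.
move=> Tin; rewrite /high_size; have le := chain_size_le l Tin.
case: N Tin le => [|N] Tin le; first by rewrite big_ord0 part_eq0.
rewrite big_ord_recl /= big1 ?addn0 // => i _.
by have := chain_sub (lift ord0 i) l Tin; rewrite row_partE /=; lia.
Qed.

Lemma row_chain_psize N k T l : T \in chains N (row_part k) -> psize (T l) = (T l)._[0].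
Proof.
move=> Tin; rewrite (psizeE (chain_size_le l Tin)) -[RHS]subn0 -(row_chain_high 0 l Tin).
by apply: eq_bigr => r _; rewrite subn0.
Qed.

Lemma row_chain_good N k la T : T \in chains N (row_part k) -> size la <= N ->
  reflect (forall i, la._[i.+1] + wt T i.+1 <= la._[i]) (good N la (row_part k) T).
Proof.
move=> Tin size_la; have m i := chain_mono 0 Tin (leqnSn i).
apply: (iffP (goodP Tin size_la)) => h.
  (* In a single row, the columns from [(T i.+1)._[0]] on contain all entries [i.+1] and no entry
     [i], so this column gives the strongest condition. *)
  move=> i; have := h (T i.+1)._[0] i.
  rewrite /dominant_at /high_wt /wt !(row_chain_high _ _ Tin) !(row_chain_psize _ Tin).
  by have := (m i, m i.+1) => -[]; lia.
move=> j i; have := h i.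
rewrite /dominant_at /high_wt /wt !(row_chain_high _ _ Tin) !(row_chain_psize _ Tin).
by have := (m i, m i.+1) => -[]; lia.
Qed.

Lemma row_chain_inj N k T T' : T \in chains N (row_part k) -> T' \in chains N (row_part k) ->
  (forall i, wt T i = wt T' i) -> T = T'.
Proof.
move=> Tin Tin' h; apply: funext => l; apply: intpart_eqP => -[|r].
  rewrite -(row_chain_psize _ Tin) -(row_chain_psize _ Tin') (chain_psize _ Tin) (chain_psize _ Tin').
  by apply: eq_bigr => i _; apply: h.
by have := chain_sub r.+1 l Tin; have := chain_sub r.+1 l Tin'; rewrite !row_partE; lia.
Qed.

Definition row_chain (w : nat -> nat) l := row_part (\sum_(i < l) w i).

Lemma row_chain_wt w i : wt (row_chain w) i = w i.
Proof. by rewrite /wt !psize_row_part sum_ordS addKn. Qed.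

Lemma row_chain_in N w : (forall i, N <= i -> w i = 0) ->
  row_chain w \in chains N (row_part (\sum_(i < N) w i)).
Proof.
move=> w0; apply/chainsP; split.
- by apply: intpart_eqP => -[|r]; rewrite row_partE // big_ord0 nth_nil.
- by move=> k; apply/hstripP => -[|r]; rewrite !row_partE // sum_ordS leq_addr.
- move=> k /subnK <-; congr row_part; elim: (k - N) => // d IH.
  by rewrite addSn sum_ordS IH w0 ?addn0 // leq_addl.
Qed.

End Rows.

Section Pieri.
Local Open Scope ring_scope.
Variables (R : idomainType) (x : nat -> R).
Hypothesis two_neq0 : 2%:R != 0 :> R.
Hypothesis x_inj : injective x.
Implicit Types la be ka mu : intpart.

(** A one-row tableau is determined by its weight and is good exactly when adding that weight to
    [ka] adds a horizontal strip. So [add_wt] is a bijection onto the [mu] with at most [N] rows;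
    for longer [mu] the Schur polynomial is 0. *)
Lemma pieri N ka k B : (psize ka + k <= B)%N ->
  schur_eval x N (row_part k) * schur_eval x N ka =
  \sum_(mu <- small_parts B | hstrip mu ka && (psize mu == psize ka + k)%N) schur_eval x N mu.
Proof.
move=> leB; case: (ltnP N (size ka)) => [lt|size_ka].
  rewrite [schur_eval x N ka]schur_eval_size // mulr0 big1 // => mu /andP[/hstrip_sizeW le _].
  by rewrite schur_eval_size // (leq_trans lt).
rewrite schur_mul // (bigID (fun mu => size mu <= N)%N) /= [X in _ + X]big1 ?addr0; last first.
  by move=> mu /andP[_]; rewrite -ltnNge => h; rewrite schur_eval_size.
rewrite -big_filter -[RHS]big_filter -(big_map (add_wt N ka) xpredT (schur_eval x N)).
apply: perm_big; apply: uniq_perm; last first.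
- move=> mu; apply/mapP/idP => [[T + ->]|].
    rewrite {1}mem_filter => /andP[gT Tin].
    have aE i := add_wtE i size_ka Tin gT.
    have sz : (size (add_wt N ka T) <= N)%N.
      by rewrite leqNgt -intpart_gt0 aE part_eq0 // (chain_wt_ge Tin).
    have ps : psize (add_wt N ka T) = (psize ka + k)%N.
      rewrite (psizeE sz) (psizeE size_ka) -[k in RHS]psize_row_part -(chain_wt_sum Tin) -big_split /=.
      by apply: eq_bigr => i _; rewrite aE.
    have /(row_chain_good Tin size_ka) h := gT.
    rewrite (mem_filter _ _ (small_parts B)) mem_small_parts sz ps eqxx leB !andbT.
    by apply/hstripP => i; rewrite !aE leq_addr.
  rewrite (mem_filter _ _ (small_parts B)) => /andP[/andP[/andP[/hstripP h /eqP ps] sz] _].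
  pose w i := (mu._[i] - ka._[i])%N.
  have w0 i : (N <= i)%N -> w i = 0%N by move=> Ni; rewrite /w part_eq0 // (leq_trans sz).
  have kE : k = (\sum_(i < N) w i)%N.
    apply/eqP; rewrite -(eqn_add2l (psize ka)) -ps (psizeE sz) (psizeE size_ka) -big_split /=.
    by apply/eqP/eq_bigr => i _; rewrite /w; have [] := h i; lia.
  have Tin := row_chain_in w0; rewrite -kE in Tin.
  have gT : good N ka (row_part k) (row_chain w).
    by apply/(row_chain_good Tin size_ka) => i; rewrite row_chain_wt /w; have := h i; have := h i.+1; lia.
  exists (row_chain w); first by rewrite mem_filter gT.
  apply: intpart_eqP => i; rewrite (add_wtE _ size_ka Tin gT) row_chain_wt /w.
  by have [] := h i; lia.
- exact/filter_uniq/uniq_small_parts.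
- rewrite map_inj_in_uniq => [|T T']; first exact/filter_uniq/chains_uniq.
  rewrite !mem_filter => /andP[g Tin] /andP[g' Tin'] E; apply: (row_chain_inj Tin Tin') => i.
  apply/eqP; rewrite -(eqn_add2l ka._[i]) -(add_wtE _ size_ka Tin g) -(add_wtE _ size_ka Tin' g').
  by rewrite E.
Qed.

End Pieri.

(** * Littlewood's identity and oscillating tableaux *)

Section EvenColumns.
Local Open Scope nat_scope.
Implicit Types (la mu be : intpart).

Lemma part_gt_count la i j : (j < la._[i]) = (i < count (fun p => j < p) la).
Proof.
case/andP: (partsP la) => + _; elim: (parts la) i => [|a s IH] i sla; first by rewrite nth_nil.
have {}IH := IH _ (path_sorted sla).
have amax k : nth 0 s k <= a.
  case: (ltnP k (size s)) => [ks|/(nth_default 0) -> //].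
  have := sla; rewrite /= path_sortedE => [/andP[/allP h _]|]; first exact/h/mem_nth.
  by move=> u v w; rewrite /geq /= => h1 h2; apply: leq_trans h2 h1.
case: (ltnP j a) => [ja|aj] /=.
  by rewrite ja; case: i => [|i] //=; rewrite IH add1n ltnS.
have -> : count (fun p => j < p) s = 0.
  apply/eqP; rewrite -leqn0 leqNgt -IH -leqNgt; exact: leq_trans (amax 0) aj.
rewrite [j < a]ltnNge aj /= ltn0; apply/negbTE; rewrite -leqNgt; case: i => [|i] //=; apply: leq_trans (amax i) aj.
Qed.

(** A column of odd height ends in a row [i.*2], and this happens exactly when row [i.*2] is longer
    than row [i.*2.+1]. *)
Lemma even_columnsP be :
  reflect (forall i, be._[i.*2] = be._[i.*2.+1]) (even_parts (conj_part be)).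
Proof.
apply: (iffP allP) => [h i|h p /mapP[j _ ->]].
  apply/eqP; rewrite eqn_leq (part_anti be (leqnSn _)) andbT leqNgt; apply/negP => lt.
  have jlt : be._[i.*2.+1] < head 0 be.
    by rewrite -nth0; apply: leq_trans lt _; apply: part_anti.
  have /h : count (fun p => be._[i.*2.+1] < p) be \in parts (conj_part be).
    by apply/mapP; exists be._[i.*2.+1]; rewrite // mem_iota.
  have := part_gt_count be i.*2 be._[i.*2.+1]; have := part_gt_count be i.*2.+1 be._[i.*2.+1].
  rewrite lt ltnn => /esym/negbT; rewrite -leqNgt => h1 /esym h2.
  by rewrite (_ : count _ _ = i.*2.+1) ?oddS ?odd_double //; lia.
set c := count _ _; apply/negP => oddc.
have cE : c = (c./2).*2.+1 by rewrite -[LHS]odd_double_half oddc.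
have := part_gt_count be (c./2).*2 j; have := part_gt_count be (c./2).*2.+1 j.
by rewrite -/c h; lia.
Qed.

(** If rows [2i] and [2i+1] of [be] agree, interlacing squeezes both to row [2i] of [mu] when
    [be/mu] is a horizontal strip, and to row [2i+1] of [mu] when [mu/be] is one. The expression
    [(r./2).*2] rounds [r] down to an even number. *)
Definition even_above mu := part_of (size mu).*2 (fun r => mu._[(r./2).*2]).
Definition even_below mu := part_of (size mu).*2 (fun r => mu._[(r./2).*2.+1]).

Let half_le r : (r./2).*2 <= (r.+1./2).*2.
Proof. by rewrite leq_double half_leq. Qed.

Lemma even_aboveE mu r : (even_above mu)._[r] = mu._[(r./2).*2].
Proof.
apply: part_ofE => [i|]; first exact/part_anti/half_le.
by rewrite part_eq0 // doubleK -addnn leq_addr.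
Qed.

Lemma even_belowE mu r : (even_below mu)._[r] = mu._[(r./2).*2.+1].
Proof.
apply: part_ofE => [i|]; first by apply: part_anti; rewrite ltnS; apply: half_le.
by rewrite part_eq0 // doubleK -addnn -addnS leq_addr.
Qed.

Lemma even_above_even mu : even_parts (conj_part (even_above mu)).
Proof. by apply/even_columnsP => i; rewrite !even_aboveE /= uphalf_double doubleK. Qed.

Lemma even_below_even mu : even_parts (conj_part (even_below mu)).
Proof. by apply/even_columnsP => i; rewrite !even_belowE /= uphalf_double doubleK. Qed.

Lemma half_cases r : r = (r./2).*2 \/ r = (r./2).*2.+1.
Proof. by case: (odd r) (odd_double_half r) => /= h; [right|left]; lia. Qed.

Lemma even_above_hstrip mu : hstrip (even_above mu) mu.
Proof.
apply/hstripP => r; rewrite !even_aboveE; split; apply: part_anti; have := half_cases r; lia.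
Qed.

Lemma even_below_hstrip mu : hstrip mu (even_below mu).
Proof.
apply/hstripP => r; rewrite !even_belowE; split; apply: part_anti; have := half_cases r; lia.
Qed.

Lemma even_above_unique mu be : even_parts (conj_part be) -> hstrip be mu -> be = even_above mu.
Proof.
move=> /even_columnsP e /hstripP h; apply: intpart_eqP => r; rewrite even_aboveE.
have [E|E] := half_cases r; rewrite {1}E; have := h (r./2).*2; have := e r./2; lia.
Qed.

Lemma even_below_unique mu be : even_parts (conj_part be) -> hstrip mu be -> be = even_below mu.
Proof.
move=> /even_columnsP e /hstripP h; apply: intpart_eqP => r; rewrite even_belowE.
have [E|E] := half_cases r; rewrite {1}E.
  by have := h (r./2).*2; have := h (r./2).*2.+1; have := e r./2; lia.
by have := h (r./2).*2; have := h (r./2).*2.+1; have := e r./2; lia.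
Qed.

Lemma psize_even_above_below mu : psize (even_above mu) + psize (even_below mu) = (psize mu).*2.
Proof.
pose M := size mu.
have sz be : be._[M.*2] = 0 -> size be <= M.*2 by move=> h; rewrite leqNgt -intpart_gt0 h.
have mu0 k : M <= k -> mu._[k] = 0 by apply: part_eq0.
rewrite (psizeE (sz (even_above mu) _)); last by rewrite even_aboveE doubleK mu0 // -addnn leq_addr.
rewrite (psizeE (sz (even_below mu) _)); last by rewrite even_belowE doubleK mu0 // -addnn -addnS leq_addr.
rewrite (psizeE (sz mu _)); last by rewrite mu0 // -addnn leq_addr.
elim: M {sz mu0} => [|M IH]; first by rewrite !big_ord0.
rewrite doubleS !(sum_ordS (fun r => (even_above mu)._[r])) !(sum_ordS (fun r => (even_below mu)._[r])).
have hM : (M.*2.+1)./2 = M by rewrite /= uphalf_double.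
by rewrite !(sum_ordS (fun r => mu._[r])) !even_aboveE !even_belowE hM doubleK; lia.
Qed.

End EvenColumns.

Section Littlewood.
Local Open Scope ring_scope.

Variables (R : idomainType) (x : nat -> R).
Hypothesis two_neq0 : 2%:R != 0 :> R.
Hypothesis x_inj : injective x.
Implicit Types la be ka mu ga : intpart.

Definition even_sum N d : R :=
  \sum_(be <- small_parts d | even_parts (conj_part be) && (psize be == d)) schur_eval x N be.

Lemma even_sumE N d B : (d <= B)%N ->
  even_sum N d = \sum_(be <- small_parts B | even_parts (conj_part be) && (psize be == d)) schur_eval x N be.
Proof.
by move=> le; apply: big_small_parts => be; case: eqP => [->|]; rewrite ?andbF // leqnn le.
Qed.

Lemma even_sum_rec N d :
  even_sum N.+1 d =
  \sum_(k < d.+1 | (k.*2 <= d)%N) x N ^+ k * (schur_eval x N (row_part k) * even_sum N (d - k.*2)).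
Proof.
(* Both sides are regrouped by the intermediate partition [mu]. On the right, [k] is forced to be
   [d - psize mu] and [ga] to be [even_below mu], of size [d - k.*2]. *)
pose F mu : R := if psize (even_above mu) == d then x N ^+ (d - psize mu) * schur_eval x N mu else 0.
transitivity (\sum_(mu <- small_parts d) F mu).
  rewrite /even_sum (eq_bigr (fun be => \sum_(mu <- small_parts d | hstrip be mu)
      x N ^+ (d - psize mu) * schur_eval x N mu)) => [|be /andP[_ /eqP psbe]]; last first.
    by rewrite (@schur_eval_rec _ _ _ _ d) ?psbe.
  rewrite (exchange_big_dep xpredT) //= big_seq [RHS]big_seq; apply: eq_bigr => mu.
  rewrite mem_small_parts => lemu; rewrite /F; case: eqP => [ps|ps].
    rewrite (@big_seq_unique _ _ _ _ (even_above mu)) ?uniq_small_parts ?mem_small_parts ?ps //.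
      by rewrite even_above_even even_above_hstrip eqxx.
    by move=> be /andP[/andP[e _] h]; apply: even_above_unique.
  rewrite big1 // => be /andP[/andP[e /eqP psbe] h].
  by case: ps; rewrite -(even_above_unique e h).
transitivity (\sum_(k < d.+1 | (k.*2 <= d)%N)
  \sum_(ga <- small_parts d | even_parts (conj_part ga) && (psize ga == d - k.*2)%N)
  \sum_(mu <- small_parts d | hstrip mu ga && (psize mu == psize ga + k)%N) x N ^+ k * schur_eval x N mu); last first.
  apply: eq_bigr => k kd; rewrite (@even_sumE _ _ d) ?leq_subr // !big_distrr /=.
  apply: eq_bigr => ga /andP[_ /eqP psga]; rewrite (@pieri _ _ _ _ _ _ _ d) ?big_distrr //.
  by rewrite psga; lia.
rewrite (eq_bigr (fun k : 'I_d.+1 => \sum_(mu <- small_parts d) \sum_(ga <- small_parts d |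
    [&& even_parts (conj_part ga), (psize ga == d - k.*2)%N, hstrip mu ga & (psize mu == psize ga + k)%N])
    x N ^+ k * schur_eval x N mu)) => [|k _]; last first.
  by rewrite (exchange_big_dep xpredT) //=; apply: eq_bigr => mu _; apply: eq_bigl => ga; rewrite -!andbA.
rewrite (exchange_big_dep xpredT) //= big_seq [RHS]big_seq; apply: eq_bigr => mu.
rewrite mem_small_parts => lemu; have ab := psize_even_above_below mu.
have lb := hstrip_psize (even_below_hstrip mu); have la := hstrip_psize (even_above_hstrip mu).
rewrite /F; case: eqP => [ps|ps]; last first.
  rewrite big1 // => k kd; rewrite big1 // => ga /and4P[e /eqP p1 h /eqP p2].
  by case: ps; move: p1 p2; rewrite (even_below_unique e h); lia.
have kd : (d - psize mu < d.+1)%N by rewrite ltnS leq_subr.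
rewrite (bigD1 (Ordinal kd)) /=; last by lia.
rewrite [X in _ + X]big1 ?addr0 => [|k /andP[kd' /eqP ne]]; last first.
  rewrite big1 // => ga /and4P[e /eqP p1 h /eqP p2]; case: ne; apply: ord_inj => /=.
  by move: p1 p2; rewrite (even_below_unique e h); lia.
rewrite (@big_seq_unique _ _ _ _ (even_below mu)) ?uniq_small_parts ?mem_small_parts //.
- rewrite even_below_even even_below_hstrip /= ifT //; apply/andP; split; apply/eqP; lia.
- exact: leq_trans lb _.
- by move=> ga /and4P[e _ h _]; apply: even_below_unique.
Qed.

End Littlewood.

Section Oscillations.
Local Open Scope ring_scope.
Implicit Types la be ka mu ga : intpart.

Section Paths.
Local Open Scope nat_scope.
Variable B : nat.

(** Infinitely many partitions extend a given one by a horizontal strip; the bound [B] keeps the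
    list finite, and [B >= n] loses no SSOT of length [n] ([ssot_path]). *)
Definition osc_pre t la : seq intpart :=
  if odd t then [seq ka <- small_parts B | hstrip la ka] else [seq mu <- small_parts B | hstrip mu la].

(* c (2i) and c (2i + 1) are the partitions S^i and S'^(i+1). *)
Definition osc_paths N la := paths part0 osc_pre N.*2 la.

Definition osc_exp (c : nat -> intpart) i :=
  (psize (c i.*2) - psize (c i.*2.+1)) + (psize (c i.*2.+2) - psize (c i.*2.+1)).

Lemma osc_paths_uniq N la : uniq (osc_paths N la).
Proof. by apply: paths_uniq => t y; rewrite /osc_pre; case: odd; apply/filter_uniq/uniq_small_parts. Qed.

End Paths.

Variables (R : idomainType) (x : nat -> R).
Hypothesis two_neq0 : 2%:R != 0 :> R.
Hypothesis x_inj : injective x.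

Definition osc_sum B N la n : R :=
  \sum_(c <- osc_paths B N la | \sum_(i < N) osc_exp c i == n :> nat) mon x N (osc_exp c).

(** Paths are cut before their last two steps, down from [mu] to [ka] and up to [la]. The test
    [e <= n] keeps [n - e] from being a truncated difference. *)
Lemma osc_sum_rec B N la n :
  osc_sum B N.+1 la n =
  \sum_(ka <- small_parts B | hstrip la ka) \sum_(mu <- small_parts B | hstrip mu ka)
    let e := ((psize mu - psize ka) + (psize la - psize ka))%N in
    if (e <= n)%N then x N ^+ e * osc_sum B N mu (n - e) else 0.
Proof.
rewrite /osc_sum /osc_paths big_mkcond doubleS big_paths.
have -> : osc_pre B N.*2.+1 la = [seq ka <- small_parts B | hstrip la ka] by rewrite /osc_pre /= odd_double.
rewrite big_filter; apply: eq_bigr => ka _; rewrite big_paths.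
have -> : osc_pre B N.*2 ka = [seq mu <- small_parts B | hstrip mu ka] by rewrite /osc_pre odd_double.
rewrite big_filter; apply: eq_bigr => mu _ /=.
set e := (_ + _)%N; rewrite big_mkcond /=.
have E c : c \in paths part0 (osc_pre B) N.*2 mu ->
    let c' := extend N.*2.+1 la (extend N.*2 ka c) in
    (forall i, (i < N)%N -> osc_exp c' i = osc_exp c i) /\ osc_exp c' N = e.
  case/mem_paths => _ _ ce c'; split=> [i iN|].
    rewrite /osc_exp /c' /extend.
    have -> : (i.*2 <= N.*2.+1)%N by lia.
    have -> : (i.*2 <= N.*2)%N by lia.
    have -> : (i.*2.+1 <= N.*2.+1)%N by lia.
    have -> : (i.*2.+1 <= N.*2)%N by lia.
    have -> : (i.*2.+2 <= N.*2.+1)%N by lia.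
    by have -> : (i.*2.+2 <= N.*2)%N by lia.
  by rewrite /osc_exp /c' /extend leqnn leqnSn ltnn ltnn leqnn ce.
case: leqP => [le|lt]; last first.
  rewrite big_seq big1 // => c /E[_ eN]; rewrite big_ord_recr /= eN; case: eqP => //; lia.
rewrite big_distrr /= [RHS]big_mkcond big_seq [RHS]big_seq; apply: eq_bigr => c /E[ei eN].
set c' := extend _ _ _ in ei eN *.
have es : (\sum_(i < N) osc_exp c' i = \sum_(i < N) osc_exp c i)%N.
  by apply: eq_bigr => i _; apply: ei.
rewrite sum_ordS eN es.
rewrite -[in X in if X then _ else _](subnK le) eqn_add2r; case: ifP => // _.
rewrite /mon big_ord_recr /= eN mulrC; congr (_ * _).
by apply: eq_bigr => i _; rewrite ei.
Qed.

Lemma even_sum0 d : even_sum x 0 d = (d == 0%N)%:R.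
Proof.
rewrite /even_sum big_mkcond (bigD1_seq part0) ?uniq_small_parts ?mem_small_parts //= big1 ?addr0.
  by rewrite schur_eval0 eqxx eq_sym; case: eqP.
by move=> be ne; rewrite schur_eval0 (negbTE ne) if_same.
Qed.

(** The identity in [N] variables, by length: a path ending at [la] has length at least [psize la],
    and the excess is the degree of the even-column factor. *)
Lemma osc_sumE B N la n : (n <= B)%N -> (psize la <= B)%N ->
  osc_sum B N la n = if (psize la <= n)%N then even_sum x N (n - psize la) * schur_eval x N la else 0.
Proof.
elim: N la n => [|N IH] la n nB laB.
  rewrite schur_eval0 even_sum0 /osc_sum /osc_paths /=.
  case: eqP => [->|_]; last by rewrite big_nil mulr0 if_same.
  by rewrite mulr1 subn0 big_mkcond big_seq1 big_ord0 /mon big_ord0 eq_sym; case: eqP.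
rewrite osc_sum_rec; case: leqP => [lan|lt]; last first.
  rewrite big_seq_cond big1 // => ka /andP[_ hka]; rewrite big_seq_cond big1 // => mu /andP[muB hmu] /=.
  have := hstrip_psize hka; have := hstrip_psize hmu; rewrite mem_small_parts in muB => h1 h2.
  case: ifP => // le; rewrite IH ?ifF ?mulr0 //; first by apply/negbTE; rewrite -ltnNge; lia.
  by rewrite (leq_trans (leq_subr _ _)).
set d := (n - psize la)%N.
have dE : (d + psize la = n)%N by rewrite subnK.
clearbody d.
rewrite (@schur_eval_rec _ _ _ _ B) // big_distrr /= big_seq_cond [RHS]big_seq_cond.
apply: eq_bigr => ka /andP[kaB hka]; have h2 := hstrip_psize hka.
rewrite even_sum_rec // big_distrl /=.
(* Pieri's formula expands the right-hand side over the same [ka] and [mu] as the left; [k] is the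
   size of [mu/ka], and [n - e - psize mu] becomes [d - k.*2]. *)
transitivity (\sum_(k < d.+1 | (k.*2 <= d)%N) \sum_(mu <- small_parts B | hstrip mu ka && (psize mu == psize ka + k)%N)
   x N ^+ k * even_sum x N (d - k.*2) * x N ^+ (psize la - psize ka) * schur_eval x N mu); last first.
  apply: eq_bigr => k kd; rewrite -big_distrr /= -(@pieri _ x) //; last by lia.
  by ring.
rewrite (exchange_big_dep (fun mu => hstrip mu ka)) => [|k mu _ /andP[]] //=.
rewrite big_seq_cond [RHS]big_seq_cond; apply: eq_bigr => mu /andP[muB hmu].
have h1 := hstrip_psize hmu; rewrite mem_small_parts in muB; rewrite hmu /=.
set e := (_ + _)%N; pose k := (psize mu - psize ka)%N.
have le_n : (n - e <= B)%N by apply: leq_trans (leq_subr _ _) nB.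
case: (leqP k.*2 d) => [kd|dk]; last first.
  rewrite big1 => [|k' /andP[k'd /eqP ek]]; last by rewrite /k in dk; lia.
  case: leqP => // le; rewrite IH // ifF ?mulr0 //; apply/negbTE; rewrite -ltnNge.
  by rewrite /k in dk; rewrite /e in le *; lia.
have kd1 : (k < d.+1)%N by lia.
rewrite (bigD1 (Ordinal kd1)) /=; last by rewrite kd /k subnKC // eqxx.
rewrite [X in _ + X]big1 ?addr0 => [|k' /andP[/andP[k'd /eqP ek] /eqP ne]]; last first.
  by case: ne; apply: ord_inj; rewrite /= /k ek addKn.
rewrite ifT; last by rewrite /k in kd; rewrite /e; lia.
rewrite IH // ifT; last by rewrite /k in kd; rewrite /e; lia.
rewrite (_ : (n - e - psize mu = d - k.*2)%N); last by rewrite /e /k; lia.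
by rewrite /e -/k exprD; ring.
Qed.

End Oscillations.

(** * From polynomials to formal power series *)

Section Counting.
Local Open Scope ring_scope.

Lemma gen_series_count (T : choiceType) (U : eqType) (A : set T) (w : T -> nat -> nat) (m : monomial)
    (s : seq U) (f : U -> T) :
  uniq s -> {in s &, injective f} ->
  (forall t, A t /\ (forall i, w t i = m i) <-> exists2 u, u \in s & t = f u) ->
  gen_series A w m = (size s)%:Z.
Proof.
move=> us injf h; rewrite /gen_series.
have -> : (A `&` [set t | forall i, w t i = m i])%classic = [set` [fset t in map f s]%fset]%classic.
  apply/seteqP; split=> t /=; rewrite inE /=.
    by move/h => [u us' ->]; apply: map_f.
  by move=> /mapP/h.
by rewrite set_fsetK card_fseq undup_id ?map_inj_in_uniq // size_map.
Qed.

Definition agree N (w m : nat -> nat) := all (fun i => w i == m i) (iota 0 N).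

Lemma agreeP N w m : reflect (forall i, (i < N)%N -> w i = m i) (agree N w m).
Proof.
apply: (iffP allP) => [h i iN|h i]; first by apply/eqP/h; rewrite mem_iota.
by rewrite mem_iota => /andP[_ iN]; apply/eqP/h.
Qed.

Variable D : nat.
Hypothesis D_gt1 : (1 < D)%N.

(* Kronecker substitution. *)
Definition kron i : {poly int} := 'X^(D ^ i).

Definition code N (w : nat -> nat) := (\sum_(i < N) w i * D ^ i)%N.

Lemma codeS N w : code N.+1 w = (code N w + w N * D ^ N)%N.
Proof. exact: (sum_ordS (fun i => w i * D ^ i)%N). Qed.

Lemma kron_inj : injective kron.
Proof.
move=> i j /(congr1 (fun p : {poly int} => size p)); rewrite !size_polyXn => -[] /eqP.
by rewrite eqn_exp2l // => /eqP.
Qed.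

Lemma poly_two_neq0 : 2%:R != 0 :> {poly int}.
Proof. by rewrite -polyC_natr polyC_eq0. Qed.

Lemma mon_kron N w : mon kron N w = 'X^(code N w).
Proof.
rewrite /mon /code; elim: N => [|N IH]; first by rewrite !big_ord0.
by rewrite big_ord_recr [in RHS]big_ord_recr /= IH exprD /kron -exprM mulnC.
Qed.

Lemma code_lt N w : (forall i, (i < N)%N -> w i < D)%N -> (code N w < D ^ N)%N.
Proof.
elim: N => [|N IH] h; first by rewrite /code big_ord0.
rewrite codeS expnS.
have := IH (fun i iN => h i (ltnW iN)); have := h N (leqnn _) => h1 h2.
have : (w N * D ^ N <= D.-1 * D ^ N)%N by rewrite leq_mul2r; apply/orP; right; lia.
have -> : (D * D ^ N = D.-1 * D ^ N + D ^ N)%N by rewrite -mulSnr prednK // ltnW.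
lia.
Qed.

(** The values of [w] are the base-[D] digits of [code N w]. *)
Lemma code_inj N w w' : (forall i, (i < N)%N -> w i < D)%N -> (forall i, (i < N)%N -> w' i < D)%N ->
  (code N w == code N w') = agree N w w'.
Proof.
move=> h h'; apply/eqP/agreeP => [|e]; last by apply: eq_bigr => i _; rewrite e.
elim: N h h' => [|N IH] h h' //; rewrite !codeS.
have lt := code_lt (fun i iN => h i (ltnW iN)); have lt' := code_lt (fun i iN => h' i (ltnW iN)).
have D0 : (0 < D ^ N)%N by rewrite expn_gt0 ltnW.
move=> E; have E1 := congr1 (divn^~ (D ^ N)%N) E; have E2 := congr1 (modn^~ (D ^ N)%N) E.
move: E1 E2; rewrite /= !divnDMl // !divn_small // !add0n => E1.
rewrite ![(_ + _ * D ^ N)%N]addnC !modnMDl !modn_small // => E2 i.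
rewrite ltnS leq_eqVlt => /orP[/eqP-> //|].
by apply: IH => // k kN; [apply: h | apply: h']; apply: ltnW.
Qed.

Lemma coef_kron N (T : eqType) (s : seq T) (P : pred T) (w : T -> nat -> nat) (m : nat -> nat) :
  (forall i, (i < N)%N -> m i < D)%N ->
  (forall t, t \in s -> P t -> forall i, (i < N)%N -> w t i < D)%N ->
  (\sum_(t <- s | P t) mon kron N (w t))`_(code N m) = (size [seq t <- s | P t && agree N (w t) m])%:Z.
Proof.
move=> hm hw; rewrite coef_sum size_filter -sum1_count -natz.
rewrite [X in X%:R]big_mkcond natr_sum [LHS]big_mkcond big_seq [RHS]big_seq /=.
apply: eq_bigr => t ts; case: (boolP (P t)) => //= Pt.
by rewrite mon_kron coefXn eq_sym code_inj //; apply: hw.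
Qed.

End Counting.

(** * Semistandard tableaux correspond to chains *)

Section Tableaux.
Local Open Scope nat_scope.
Implicit Types (nu : intpart) (c : nat -> intpart) (m : monomial).

Lemma sorted_count (s : seq nat) j k : sorted leq s -> j < size s ->
  (nth 0 s j < k) = (j < count (fun e => e < k) s).
Proof.
elim: s j => [|a s IH] j //= sas js.
have ss := path_sorted sas.
have amin e : e \in s -> a <= e.
  by move: sas; rewrite path_sortedE => [/andP[/allP h _]|]; [apply: h | apply: leq_trans].
case: (ltnP a k) => ak; first by case: j js => [|j] js //=; rewrite add1n ltnS IH.
have -> : count (fun e => e < k) s = 0.
  apply/eqP; rewrite -leqn0 leqNgt -has_count; apply/hasPn => e /amin ae.
  by rewrite -leqNgt (leq_trans ak ae).
rewrite addn0 ltn0; apply/negbTE; rewrite -leqNgt; case: j js => [|j] js //=.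
by apply: leq_trans ak (amin _ (mem_nth _ _)).
Qed.

Lemma count_antitone (p : pred nat) N k : (forall i, p i.+1 -> p i) -> k < N ->
  (count p (iota 0 N) <= k) = ~~ p k.
Proof.
move=> pS; have anti i j : i <= j -> p j -> p i.
  by move/subnK <-; elim: (j - i) => // d IH; rewrite addSn => /pS.
elim: N => // N IH; rewrite ltnS => kN.
rewrite -addn1 iotaD count_cat /= add0n addn0; case: (boolP (p N)) => pN.
  have -> : count p (iota 0 N) = N.
    rewrite -[RHS](size_iota 0); apply/eqP; rewrite -all_count; apply/allP => i.
    by rewrite mem_iota => /andP[_ iN]; apply: anti pN; apply: ltnW.
  by rewrite (anti k N kN pN) /= addn1 ltnNge kN.
rewrite addn0; case: (ltngtP k N) kN => // [lt _|-> _]; first exact: IH.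
by rewrite pN -[X in _ <= X](size_iota 0) count_size.
Qed.

Lemma count_iota_lt a b : count (fun j => j < a) (iota 0 b) = minn a b.
Proof.
elim: b => [|b IH]; first by rewrite minn0.
by rewrite -addn1 iotaD count_cat IH /= add0n; case: (ltnP b a); lia.
Qed.

Section Chain.
Variables (N : nat) (nu : intpart) (c : nat -> intpart).

(** The chain increases, so the number of [k] for which [c k.+1] still lacks the box is the index at
    which the box is added. *)
Definition entry r j := count (fun k => (c k.+1)._[r] <= j) (iota 0 N).

Definition tableau := [seq [seq entry r j | j <- iota 0 nu._[r]] | r <- iota 0 (size nu)].

Hypothesis cin : c \in chains N nu.

Lemma nth_tableau r : nth [::] tableau r = [seq entry r j | j <- iota 0 nu._[r]].
Proof.
case: (ltnP r (size nu)) => rn; first by rewrite (nth_map 0) ?size_iota // nth_iota.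
by rewrite nth_default ?size_map ?size_iota // part_eq0.
Qed.

Lemma entry_lt r j k : j < nu._[r] -> k <= N -> (entry r j < k) = (j < (c k)._[r]).
Proof.
have /chainsP[c0 cs ce] := cin; move=> jr; case: k => [|k] kN; first by rewrite ltn0 c0 nth_nil.
rewrite ltnS count_antitone // -?ltnNge // => i.
by apply: leq_trans; have /hstripP/(_ r)[] := cs i.+1.
Qed.

Lemma count_row_lt r k : k <= N ->
  count (fun e => e < k) (nth [::] tableau r) = (c k)._[r].
Proof.
move=> kN; rewrite nth_tableau count_map.
rewrite (eq_in_count (a2 := fun j => j < (c k)._[r])) => [|j]; last first.
  by rewrite mem_iota => /andP[_ jr]; apply: entry_lt.
by rewrite count_iota_lt; apply/minn_idPl/(chain_sub _ _ cin).
Qed.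

Lemma count_row r i : i < N ->
  count_mem i (nth [::] tableau r) = (c i.+1)._[r] - (c i)._[r].
Proof.
move=> iN; rewrite -!count_row_lt ?(ltnW iN) //; set s := nth _ _ _.
elim: s => //= e s IH; rewrite IH ltnS.
have : count (fun e => e < i) s <= count (fun e => e < i.+1) s by apply: sub_count => k /= /ltnW.
case: (ltngtP e i); lia.
Qed.

Lemma tableau_weight i : count_mem i (flatten tableau) = wt c i.
Proof.
case: (ltnP i N) => [iN|Ni]; last first.
  rewrite (chain_wt_ge cin) //; apply/eqP; rewrite -leqn0 leqNgt -has_count; apply/hasPn => e.
  move=> /flattenP[_ /mapP[r _ ->] /mapP[j + ->]]; rewrite mem_iota => /andP[_ jr].
  rewrite /= neq_ltn; apply/orP; left; apply: leq_trans Ni; rewrite entry_lt //.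
  by have /chainsP[_ _ ->] := cin.
have sz k : size (c k) <= size nu.
  by rewrite leqNgt -intpart_gt0 -leqNgt (leq_trans (chain_sub _ _ cin)) // part_eq0.
rewrite /wt !(psizeE (sz _)) count_flatten sumnE big_map /tableau big_map.
rewrite (eq_bigr (fun r => (c i.+1)._[r] - (c i)._[r])) => [|r _]; last first.
  by rewrite -nth_tableau count_row.
rewrite -(big_mkord xpredT (fun r => (c i.+1)._[r])) -(big_mkord xpredT (fun r => (c i)._[r])).
rewrite /index_iota subn0 -sumnB // => r _.
by have /chainsP[_ /(_ i) /hstripP/(_ r)[]] := cin.
Qed.

Lemma tableau_ssyt : ssyt nu tableau.
Proof.
have /chainsP[c0 cs ce] := cin; split.
- apply: (@eq_from_nth _ 0); rewrite !size_map size_iota // => r rn.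
  rewrite (nth_map [::]) ?size_map ?size_iota // nth_tableau size_map size_iota //.
- apply/allP => _ /mapP[r _ ->]; apply: homo_sorted (iota_sorted 0 _) => i j ij.
  by apply: sub_count => k /leq_trans; apply.
move=> r j; rewrite !nth_tableau size_map size_iota => jr1.
have jr : j < nu._[r] by apply: leq_trans jr1 (part_anti _ _).
rewrite !(nth_map 0) ?size_iota // !nth_iota // !add0n.
have eN : entry r.+1 j < N by rewrite entry_lt // ce.
rewrite entry_lt //; last exact: ltnW.
have : j < (c (entry r.+1 j).+1)._[r.+1] by rewrite -entry_lt.
by move=> h; apply: leq_trans h _; have /hstripP/(_ r)[] := cs (entry r.+1 j).
Qed.

End Chain.

Lemma tableau_inj N nu : {in chains N nu &, injective (tableau N nu)}.
Proof.
move=> c c' cin cin' E; apply: funext => k; apply: intpart_eqP => r.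
case: (leqP k N) => [kN|/ltnW Nk].
  by rewrite -(count_row_lt cin r kN) -(count_row_lt cin' r kN) E.
by have /chainsP[_ _ e] := cin; have /chainsP[_ _ e'] := cin'; rewrite e // e'.
Qed.

Section Untableau.
Variables (N : nat) (nu : intpart) (T : seq (seq nat)).
Hypotheses (Tssyt : ssyt nu T) (T_lt : forall e, e \in flatten T -> e < N).

Let row r := nth [::] T r.

Let size_row r : size (row r) = nu._[r].
Proof.
case: Tssyt => + _ _; rewrite /row => <-.
case: (ltnP r (size T)) => rT; first by rewrite (nth_map [::]).
by rewrite !nth_default ?size_map.
Qed.

Let row_sorted r : sorted leq (row r).
Proof.
case: Tssyt => _ /allP h _; rewrite /row.
case: (ltnP r (size T)) => rT; first exact/h/mem_nth.
by rewrite nth_default.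
Qed.

Let row_lt r e : e \in row r -> e < N.
Proof.
move=> h; apply: T_lt; apply/flattenP; exists (row r) => //; apply: mem_nth.
by rewrite ltnNge; apply/negP => rT; rewrite /row nth_default in h.
Qed.

Definition row_count k r := count (fun e => e < k) (nth [::] T r).

Definition tableau_chain k : intpart := part_of (size nu) (row_count k).

Let count_col k r : row_count k.+1 r.+1 <= row_count k r.
Proof.
case: Tssyt => _ _ col; rewrite /row_count -!/(row _).
(* If row [r.+1] has [b.+1] entries [<= k], its entry in column [b] is one of them; the entry above
   it is [< k] by column strictness, so row [r] has more than [b] entries [< k]. *)
set a := count _ (row r.+1); case E : a => [//|b].
have b_lt : b < size (row r.+1) by rewrite -E; apply: count_size.
have h1 : nth 0 (row r.+1) b < k.+1 by rewrite sorted_count // -/a E.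
have h2 := col r b b_lt.
rewrite -sorted_count //; first exact: leq_trans h2 h1.
by rewrite size_row (leq_trans b_lt) // size_row part_anti.
Qed.

Let count_mono k r : row_count k r <= row_count k.+1 r.
Proof. by apply: sub_count => e /= /ltnW. Qed.

Lemma tableau_chainE k r : (tableau_chain k)._[r] = row_count k r.
Proof.
apply: part_ofE => [j|]; first exact: leq_trans (count_mono _ _) (count_col _ _).
by apply/eqP; rewrite -leqn0 (leq_trans (count_size _ _)) // -/(row _) size_row part_eq0.
Qed.

Lemma tableau_chain_in : tableau_chain \in chains N nu.
Proof.
apply/chainsP; split=> [|k|k Nk].
- apply: intpart_eqP => r; rewrite tableau_chainE nth_nil; apply/eqP.
  by rewrite -leqn0 leqNgt -has_count; apply/hasPn.
- by apply/hstripP => r; rewrite !tableau_chainE.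
- apply: intpart_eqP => r; rewrite tableau_chainE -size_row; apply/eqP.
  by rewrite -all_count; apply/allP => e /row_lt h; apply: leq_trans Nk.
Qed.

Lemma tableau_chainK : tableau N nu tableau_chain = T.
Proof.
have szT : size T = size nu by case: Tssyt => <- _ _; rewrite size_map.
apply: (@eq_from_nth _ [::]); first by rewrite size_map size_iota szT.
move=> r _; rewrite nth_tableau -/(row r).
apply: (@eq_from_nth _ 0); first by rewrite size_map size_iota size_row.
rewrite size_map size_iota => j jr; rewrite (nth_map 0) ?size_iota // nth_iota // add0n.
set e := nth 0 (row r) j.
have eN : e < N by apply: (@row_lt r); rewrite mem_nth // size_row.
have ek k : k <= N -> (entry N tableau_chain r j < k) = (e < k).
  move=> kN; rewrite (entry_lt tableau_chain_in) // tableau_chainE /row_count -/(row r).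
  by rewrite -sorted_count ?size_row.
apply/eqP; rewrite eqn_leq -ltnS ek // ltnSn /=.
have : entry N tableau_chain r j < N by rewrite ek.
by move=> h; rewrite -ltnS -ek.
Qed.

End Untableau.

(** A tableau of weight [m] has all its entries below [N], so it comes from a chain of length
    [N]. *)
Lemma schur_count nu m N : (forall i, N <= i -> m i = 0) ->
  schur nu m = Posz (size [seq c <- chains N nu | agree N (wt c) m]).
Proof.
move=> m0; apply: (gen_series_count (f := tableau N nu)).
- exact/filter_uniq/chains_uniq.
- by move=> c c'; rewrite !mem_filter => /andP[_ h] /andP[_ h']; apply: tableau_inj.
move=> T; split=> [[Ts hT]|[c + ->]]; last first.
  rewrite mem_filter => /andP[/agreeP h cin]; split; first exact: tableau_ssyt.
  move=> i; rewrite (tableau_weight cin); case: (ltnP i N) => [/h //|Ni].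
  by rewrite m0 // (chain_wt_ge cin).
have T_lt e : e \in flatten T -> e < N.
  rewrite ltnNge => h; apply/negP => /m0; rewrite -hT => /eqP.
  by rewrite -leqn0 leqNgt -has_count; move/hasPn/(_ e h); rewrite /= eqxx.
have cin := tableau_chain_in Ts T_lt; have cK := tableau_chainK Ts T_lt.
exists (tableau_chain nu T) => //; rewrite mem_filter cin andbT; apply/agreeP => i _.
by rewrite -(tableau_weight cin) cK.
Qed.

End Tableaux.

(** * SSOTs correspond to finite oscillating paths *)

Section SSOT.
Local Open Scope nat_scope.
Implicit Types (la : intpart) (c : nat -> intpart) (m : monomial).

Definition osc_of_path c : oscillation := (fun i => c i.*2, fun i => c i.*2.+1).

Lemma osc_of_path_inj : injective osc_of_path.
Proof.
move=> c c' [] E1 E2; apply: funext => k.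
have := congr1 (fun g : nat -> intpart => g k./2) E1; have := congr1 (fun g : nat -> intpart => g k./2) E2.
by have [<-|<-] := half_cases k.
Qed.

Lemma ssot_lengthE (S : oscillation) N : (forall i, N <= i -> ssot_exp S i = 0) ->
  ssot_length S = \sum_(i < N) ssot_exp S i.
Proof.
move=> h; rewrite /ssot_length (fsbigE (iota 0 N)) ?iota_uniq //; last first.
  by move=> i _; rewrite mem_iota add0n -leqNgt => /h.
rewrite (eq_bigl xpredT) => [|i]; last exact: in_setT.
by rewrite -(big_mkord xpredT) /index_iota subn0.
Qed.

Lemma osc_path_ssot B N la c : c \in osc_paths B N la -> is_ssot la (osc_of_path c).
Proof.
case/mem_paths => c0 cs ce.
have h1 i : hstrip (c i.*2) (c i.*2.+1).
  case: (ltnP i N) => iN; last by rewrite !ce ?hstrip_refl //; lia.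
  have := cs i.*2 ltac:(lia); by rewrite /osc_pre odd_double mem_filter => /andP[].
have h2 i : hstrip (c i.*2.+2) (c i.*2.+1).
  case: (ltnP i N) => iN; last by rewrite !ce ?hstrip_refl //; lia.
  have := cs i.*2.+1 ltac:(lia); by rewrite /osc_pre /= odd_double mem_filter => /andP[].
split=> [||i|] /=; first exact: c0.
- by apply: psize_eq0; have := hstrip_psize (h1 0); rewrite c0 /=; rewrite /psize /=; lia.
- by split; apply/horizontal_stripP; rewrite ?doubleS.
- by exists N => i Ni; rewrite !ce //; lia.
Qed.

Lemma ssot_path la n m N B (S : oscillation) : (forall i, N <= i -> m i = 0) -> n <= B ->
  is_ssot la S -> ssot_length S = n -> (forall i, ssot_exp S i = m i) ->
  exists2 c, c \in [seq c <- osc_paths B N la |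
    (\sum_(i < N) osc_exp c i == n) && agree N (osc_exp c) m] & S = osc_of_path c.
Proof.
move=> m0 nB [S10 S20 Shs [i0 Si0]] en hS; move: nB; rewrite -{}en.
have h1 i : hstrip (S.1 i) (S.2 i) by apply/horizontal_stripP; case: (Shs i).
have h2 i : hstrip (S.1 i.+1) (S.2 i) by apply/horizontal_stripP; case: (Shs i).
have ex i : N <= i -> ssot_exp S i = 0 by move=> Ni; rewrite hS m0.
rewrite (ssot_lengthE ex) => nB.
(* A zero exponent makes both strips empty, so the sequence is constant from [N] on; being
   eventually [la], it equals [la] already there. *)
have const i : N <= i -> S.2 i = S.1 i /\ S.1 i.+1 = S.1 i.
  move=> Ni; have := ex i Ni; rewrite /ssot_exp /skew_size => e.
  have a1 : S.1 i = S.2 i.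
    by apply: sub_psize_eq => [r|]; [case/hstripP/(_ r): (h1 i) | lia].
  have a2 : S.1 i.+1 = S.2 i.
    by apply: sub_psize_eq => [r|]; [case/hstripP/(_ r): (h2 i) | lia].
  by rewrite a2 a1.
have S1la i : N <= i -> S.1 i = la.
  move=> Ni; have [<- _] := Si0 (i + i0) (leq_addl _ _).
  elim: i0 {Si0} => [|k IH]; first by rewrite addn0.
  by rewrite addnS; have [_ ->] := const (i + k) (leq_trans Ni (leq_addr _ _)).
(* A partition grows at each step by at most the exponent of that step, so its size never exceeds
   the length. *)
have S1le i : psize (S.1 i) <= B.
  apply: leq_trans nB; have le k : psize (S.1 k) <= \sum_(j < k) ssot_exp S j.
    elim: k => [|k IH]; first by rewrite S10.
    rewrite sum_ordS /ssot_exp /skew_size; have := hstrip_psize (h1 k); have := hstrip_psize (h2 k).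
    by move: IH; rewrite /ssot_exp /skew_size; lia.
  have mono k : k <= N -> \sum_(j < k) ssot_exp S j <= \sum_(j < N) ssot_exp S j.
    by move=> kN; rewrite (big_ord_widen _ _ kN) big_mkcond leq_sum // => j _; case: ifP.
  case: (leqP i N) => [iN|/ltnW Ni]; first exact: leq_trans (le i) (mono _ iN).
  by rewrite S1la // -(S1la N) // (leq_trans (le N)).
pose c k := if odd k then S.2 k./2 else S.1 k./2.
have c1 i : c i.*2 = S.1 i by rewrite /c odd_double doubleK.
have c2 i : c i.*2.+1 = S.2 i by rewrite /c /= odd_double /= uphalf_double.
have cS : S = osc_of_path c.
  by rewrite [LHS]surjective_pairing /osc_of_path; congr pair; apply: funext => i; rewrite ?c1 ?c2.
have ce i : osc_exp c i = ssot_exp S i by rewrite /osc_exp /ssot_exp -doubleS !c1 c2.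
exists c => //; rewrite mem_filter -andbA; apply/and3P; split.
- by apply/eqP/eq_bigr => i _; rewrite ce.
- by apply/agreeP => i _; rewrite ce hS.
apply/mem_paths; split=> [|k kN|k Nk].
- by rewrite -[0]/(0.*2) c1.
- rewrite /osc_pre; have [E|E] := half_cases k; rewrite E /= odd_double /= mem_filter mem_small_parts.
    by rewrite c1 c2 h1 S1le.
  rewrite -doubleS c1 c2 h2; apply: leq_trans (hstrip_psize (h2 _)) (S1le _).
- have [E|E] := half_cases k; rewrite E ?c1 ?c2.
    by apply: S1la; lia.
  by have [-> _] := const k./2 ltac:(lia); apply: S1la; lia.
Qed.

Lemma ss_count la n m N B : (forall i, N <= i -> m i = 0) -> n <= B ->
  ss la n m = Posz (size [seq c <- osc_paths B N la |
    (\sum_(i < N) osc_exp c i == n) && agree N (osc_exp c) m]).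
Proof.
move=> m0 nB; apply: (gen_series_count (f := osc_of_path)).
- exact/filter_uniq/osc_paths_uniq.
- by move=> c c' _ _; apply: osc_of_path_inj.
move=> S; split=> [[[Sla en] hS]|[c + ->]]; last first.
  rewrite mem_filter => /andP[/andP[/eqP en /agreeP h] cin].
  have Sla := osc_path_ssot cin.
  have ex i : N <= i -> ssot_exp (osc_of_path c) i = 0.
    case/mem_paths: cin => _ _ ce Ni.
    by rewrite /ssot_exp /skew_size /= !ce ?subnn //; lia.
  split=> [|i]; first by split; rewrite // (ssot_lengthE ex) -en.
  case: (ltnP i N) => [/h <-|Ni]; first by rewrite /ssot_exp /osc_exp /= doubleS.
  by rewrite ex ?m0.
by apply: ssot_path.
Qed.

End SSOT.

(** * Products of Schur functions as sums over pairs of tableaux *)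

Section Products.
Local Open Scope ring_scope.
Implicit Types (la be nu : intpart) (m : monomial).

Definition exp_monomial N (w : nat -> nat) : monomial :=
  seq_mset (flatten [seq nseq (w i) i | i <- iota 0 N]).

Lemma exp_monomialE N w i : exp_monomial N w i = if (i < N)%N then w i else 0%N.
Proof.
rewrite /exp_monomial mset_seqE; elim: N => [|N IH] //.
rewrite -addn1 iotaD map_cat flatten_cat count_cat IH /= cats0 add0n count_nseq /= addn1 ltnS.
by case: (ltngtP i N) => [lt|lt|->]; rewrite /= ?mul0n ?mul1n ?addn0 //; rewrite ltnn mul1n.
Qed.

Lemma exp_monomial_eq N w m : (forall i, (N <= i)%N -> m i = 0%N) ->
  (exp_monomial N w == m) = agree N w m.
Proof.
move=> m0; apply/eqP/agreeP => [<- i iN|h]; first by rewrite exp_monomialE iN.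
by apply/msetP => i; rewrite exp_monomialE; case: ltnP => [/h //|/m0 ->].
Qed.

Lemma schur_sum nu m N : (forall i, (N <= i)%N -> m i = 0%N) ->
  schur nu m = \sum_(c <- chains N nu) (exp_monomial N (wt c) == m)%:R.
Proof.
move=> m0; rewrite (schur_count _ m0) size_filter -sum1_count -natz natr_sum big_mkcond.
by apply: eq_bigr => c _; rewrite exp_monomial_eq //; case: agree.
Qed.

Lemma sum_eq_mem (T : eqType) (s : seq T) (t : T) : uniq s ->
  \sum_(u <- s) ((t == u)%:R : int) = (t \in s)%:R.
Proof.
move=> us; rewrite -count_uniq_mem // -sum1_count natr_sum [RHS]big_mkcond /=.
by apply: eq_bigr => u _; rewrite eq_sym; case: eqP.
Qed.

Lemma fps_mul_schur be la m N : (forall i, (N <= i)%N -> m i = 0%N) ->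
  fps_mul (schur be) (schur la) m =
  \sum_(T <- chains N be) \sum_(T' <- chains N la) (agree N (fun i => wt T i + wt T' i)%N m)%:R.
Proof.
move=> m0.
pose P := [seq (exp_monomial N (wt T), exp_monomial N (wt T')) | T <- chains N be, T' <- chains N la].
(* A pair of monomials with product [m] contributes only if both occur as weights of tableaux, so
   this finite list contains the support; each pair of tableaux then meets exactly one of its
   elements. *)
pose L := undup [seq ab <- P | msetD ab.1 ab.2 == m].
have abz (ab : monomial * monomial) : msetD ab.1 ab.2 = m ->
    (forall i, (N <= i)%N -> ab.1 i = 0%N) /\ (forall i, (N <= i)%N -> ab.2 i = 0%N).
  by move=> E; split=> i /m0; rewrite -E msetE2; lia.
rewrite /fps_mul (fsbigE L) ?undup_uniq //; first last.
- move=> ab /= abm; rewrite mem_undup mem_filter abm eqxx /= => nin.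
  have [a0 b0] := abz _ abm; rewrite (schur_sum _ a0) (schur_sum _ b0).
  rewrite big_distrl /= big_seq big1 // => T Tin; rewrite big_distrr /= big_seq big1 // => T' Tin'.
  case: eqP => [e1|_]; last by rewrite mul0r.
  case: eqP => [e2|_]; last by rewrite mulr0.
  case/negP: nin; apply/allpairsP; exists (T, T'); split=> //=.
  by rewrite e1 e2 -surjective_pairing.
- by move=> ab /=; rewrite mem_undup mem_filter => /andP[/eqP].
rewrite big_seq_cond (eq_bigr (fun ab => \sum_(T <- chains N be) \sum_(T' <- chains N la)
    ((exp_monomial N (wt T), exp_monomial N (wt T')) == ab)%:R)); last first.
  move=> ab /andP[]; rewrite mem_undup mem_filter => /andP[/eqP abm _] _.
  have [a0 b0] := abz _ abm; rewrite (schur_sum _ a0) (schur_sum _ b0).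
  rewrite big_distrl /=; apply: eq_bigr => T _; rewrite big_distrr /=; apply: eq_bigr => T' _.
  by rewrite -natrM mulnb -pair_eqE.
rewrite (eq_bigl (fun ab => ab \in L)) => [|ab]; last first.
  case: (boolP (ab \in L)) => //=; rewrite mem_undup mem_filter => /andP[/eqP h _].
  by apply/idP; rewrite inE.
rewrite -big_seq exchange_big /= big_seq [RHS]big_seq; apply: eq_bigr => T Tin.
rewrite exchange_big /= big_seq [RHS]big_seq; apply: eq_bigr => T' Tin'.
rewrite sum_eq_mem ?undup_uniq // mem_undup mem_filter.
have -> : (exp_monomial N (wt T), exp_monomial N (wt T')) \in P.
  by apply/allpairsP; exists (T, T').
rewrite andbT -(exp_monomial_eq _ m0); congr (_%:R); congr (nat_of_bool (_ == m)).
by apply/msetP => i; rewrite msetE2 !exp_monomialE; case: ltnP.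
Qed.

End Products.

(** * Littlewood-Richardson coefficients *)

Section LRShapes.
Local Open Scope nat_scope.
Implicit Types (la be nu : intpart) (T : nat -> intpart).

Lemma chain_wt_le N nu T i : T \in chains N nu -> wt T i <= psize nu.
Proof.
move=> Tin; case: (ltnP i N) => [iN|Ni]; last by rewrite (chain_wt_ge Tin).
by rewrite -(chain_wt_sum Tin) (bigD1 (Ordinal iN)) //= leq_addr.
Qed.

Section OneTableau.
Variables (N : nat) (la be : intpart) (T : nat -> intpart).
Hypotheses (size_la : size la <= N) (Tin : T \in chains N be) (gT : good N la be T).

Lemma size_add_wt : size (add_wt N la T) <= N.
Proof. by rewrite leqNgt -intpart_gt0 (add_wtE _ size_la Tin gT) part_eq0 // (chain_wt_ge Tin). Qed.

Lemma psize_add_wt : psize (add_wt N la T) = psize la + psize be.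
Proof.
rewrite (psizeE size_add_wt) (psizeE size_la) -(chain_wt_sum Tin) -big_split /=.
by apply: eq_bigr => i _; rewrite (add_wtE _ size_la Tin gT).
Qed.

(** If [i] occurs in [T], rows [0] to [i] of the partition [la + wt T] are nonempty. So every [r]
    from [size la] to [i] occurs in [T], which makes more than [psize be] entries. *)
Lemma good_wt_bounded i : size la + psize be <= i -> wt T i = 0.
Proof.
move=> le; apply/eqP; rewrite -leqn0 leqNgt; apply/negP => wi.
have pos r : r <= i -> 0 < la._[r] + wt T r.
  move=> ri; rewrite -(add_wtE _ size_la Tin gT); apply: leq_trans (part_anti _ ri).
  by rewrite (add_wtE _ size_la Tin gT) ltn_addl.
have iN : i < N by rewrite ltnNge; apply/negP => /(chain_wt_ge Tin) w0; rewrite w0 in wi.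
have := chain_wt_sum Tin; apply/eqP; rewrite gtn_eqF //.
have : \sum_(r < i.+1) (size la <= r) <= \sum_(r < i.+1) wt T r.
  apply: leq_sum => r _; case: (leqP (size la) r) => // h.
  by have := pos r (ltn_ord r); rewrite (part_eq0 h).
have E k : \sum_(r < k) (size la <= r) = k - size la.
  elim: k => [|k IH]; first by rewrite big_ord0.
  by rewrite (sum_ordS (fun r => nat_of_bool (size la <= r))) IH; case: leqP; lia.
rewrite E => h1; have : \sum_(r < i.+1) wt T r <= \sum_(r < N) wt T r.
  by rewrite (big_ord_widen _ (wt T) iN) big_mkcond leq_sum // => r _; case: ifP.
by lia.
Qed.

Lemma high_wt_wt l : high_wt N T 0 l = wt T l.
Proof.
rewrite /high_wt /wt /high_size !(psizeE (chain_size_le _ Tin)).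
by congr subn; apply: eq_bigr => r _; rewrite subn0.
Qed.

End OneTableau.

Lemma high_size_widen M N T j k : size (T k) <= M -> M <= N -> high_size N T j k = high_size M T j k.
Proof.
move=> szM MN; rewrite /high_size (big_ord_widen _ (fun r => (T k)._[r] - j) MN) [RHS]big_mkcond.
by apply: eq_bigr => r _; case: ltnP => // Mr; rewrite part_eq0 // (leq_trans szM).
Qed.

(** The number of variables grows with the monomial under study, whereas [lr_shapes] has to be one
    list valid for all monomials. *)
Lemma good_stable N la be T : size la + psize be <= N ->
  (T \in chains N be) && good N la be T =
  (T \in chains (size la + psize be) be) && good (size la + psize be) la be T.
Proof.
set M := size la + psize be => MN.
have laM : size la <= M by apply: leq_addr.
have laN := leq_trans laM MN.
have sub : T \in chains M be -> T \in chains N be.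
  case/chainsP => T0 Ts Te; apply/chainsP; split=> // k Nk; apply: Te; exact: leq_trans Nk.
have dom j i : T \in chains M be -> dominant_at N la T j i = dominant_at M la T j i.
  by move=> Tin; rewrite /dominant_at /high_wt !(high_size_widen _ (chain_size_le _ Tin) MN).
apply/andP/andP => [[Tin g]|[Tin g]]; last first.
  have Tin' := sub Tin; split=> //; apply/(goodP Tin' laN) => j i.
  by rewrite dom //; move/(goodP Tin laM): g; apply.
have Tin' : T \in chains M be.
  have /chainsP[T0 Ts Te] := Tin; apply/chainsP; split=> // k Mk.
  have step l : M <= l -> T l.+1 = T l.
    move=> Ml; have := good_wt_bounded laN Tin g Ml; rewrite /wt => /eqP; rewrite subn_eq0 => le.
    by apply: sub_psize_eq le => r; case/hstripP/(_ r): (Ts l).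
  rewrite -(Te (k + N) (leq_addl _ _)); elim: {Te Tin g laN MN sub dom} N => [|d IH]; first by rewrite addn0.
  by rewrite addnS step // (leq_trans Mk) // leq_addr.
split=> //; apply/(goodP Tin' laM) => j i; rewrite -dom //.
by move/(goodP Tin laN): g; apply.
Qed.

(* With multiplicity, the shapes of the Schur functions occurring in s_be s_la. *)
Definition lr_shapes be la :=
  let N := size la + psize be in [seq add_wt N la T | T <- chains N be & good N la be T].

Lemma big_lr_shapes (V : nmodType) be la N (F : intpart -> V) : size la + psize be <= N ->
  (\sum_(T <- chains N be | good N la be T) F (add_wt N la T) = \sum_(nu <- lr_shapes be la) F nu)%R.
Proof.
move=> MN; rewrite /lr_shapes big_map -[LHS]big_filter.
have laM : size la <= size la + psize be by apply: leq_addr.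
have -> : (\sum_(T <- [seq T <- chains N be | good N la be T]) F (add_wt N la T) =
    \sum_(T <- [seq T <- chains N be | good N la be T]) F (add_wt (size la + psize be) la T))%R.
  rewrite big_seq [RHS]big_seq; apply: eq_bigr => T; rewrite mem_filter andbC => h.
  have := h; rewrite good_stable // => /andP[Tin' g']; case/andP: h => Tin g.
  congr F; apply: intpart_eqP => i.
  by rewrite (add_wtE _ _ Tin g) ?(leq_trans laM) // (add_wtE _ laM Tin' g').
apply: perm_big; apply: uniq_perm => [||T]; try exact/filter_uniq/chains_uniq.
by rewrite !mem_filter ![good _ _ _ _ && _]andbC good_stable.
Qed.

Lemma psize_lr_shapes be la nu : nu \in lr_shapes be la -> psize nu = psize la + psize be.
Proof.
by case/mapP => T; rewrite mem_filter => /andP[g Tin] ->; rewrite (psize_add_wt _ Tin g) // leq_addr.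
Qed.

(* The columns of T, added to la from right to left, are vertical strips. *)
Lemma lr_shapes_Vset be la nu : even_parts (conj_part be) -> nu \in lr_shapes be la ->
  Vset (psize la + psize be) la nu.
Proof.
move=> ev nuin; split; first exact: psize_lr_shapes.
case/mapP: nuin => T; rewrite mem_filter => /andP[g Tin] ->.
set N := _ + _ in g Tin *; have size_la : size la <= N by apply: leq_addr.
have dom := elimT (goodP Tin size_la) g.
(* Stage [s] adds to [la] the columns [>= psize be - s]. Since [psize be] may exceed the number of
   columns, the first stages can be empty strips, of even size 0. *)
pose c s := part_of N (fun i => la._[i] + high_wt N T (psize be - s) i).
have cE s i : (c s)._[i] = la._[i] + high_wt N T (psize be - s) i.
  by apply: part_ofE => [k|]; [apply: dom | rewrite part_eq0 // (high_wt_ge Tin)].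
have csize s : size (c s) <= N.
  by rewrite leqNgt -intpart_gt0 cE part_eq0 // (high_wt_ge Tin).
have h0 j : high_size N T j 0 = 0.
  by apply: big1 => r _; case/chainsP: Tin => -> _ _; rewrite nth_nil.
have tele j k : \sum_(i < k) high_wt N T j i = high_size N T j k.
  elim: k => [|k IH]; first by rewrite big_ord0 h0.
  by rewrite sum_ordS IH /high_wt subnKC // (high_size_mono Tin).
have cps s : psize (c s) = psize la + high_size N T (psize be - s) N.
  rewrite (psizeE (csize s)) (psizeE size_la) -tele -big_split /=.
  by apply: eq_bigr => i _; rewrite cE.
exists (psize be), c; split.
- apply: intpart_eqP => i; rewrite cE subn0 /high_wt !(high_size0 Tin) ?subnn ?addn0 //.
- apply: intpart_eqP => i; rewrite cE subnn (high_wt_wt Tin) (add_wtE _ size_la Tin g) //.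
move=> s slt; set j := psize be - s.+1; have jE : psize be - s = j.+1 by rewrite /j; lia.
(* A column contains each entry at most once, so every row grows by at most one box. *)
have diff i : (c s)._[i] <= (c s.+1)._[i] <= (c s)._[i].+1.
  rewrite !cE jE -/j /high_wt.
  have := high_size_mono Tin j.+1 (leqnSn i); rewrite !(high_size_col N T j).
  have := col_size_mono Tin j i; have := col_size_step Tin j i; lia.
split.
  split=> [i k|i k1 k2]; rewrite /skew_box /box; first by have := diff i; lia.
  by have := diff i; lia.
rewrite /skew_size !cps jE -/j (high_size_col N T j).
rewrite [X in X - _](_ : _ = psize la + high_size N T j.+1 N + col_size N T j N); last by lia.
rewrite addKn /col_size; have /chainsP[_ _ ->] := Tin => //.
have sb : size be <= N by apply: chains_size Tin.
have -> : \sum_(r < N) (j < be._[r]) = count (fun p => j < p) be.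
  rewrite (eq_bigr (fun r : 'I_N => nat_of_bool (r < count (fun p => j < p) be))) => [|r _]; last first.
    by rewrite part_gt_count.
  set a := count _ _; have aN : a <= N by apply: leq_trans (count_size _ _) sb.
  rewrite -[RHS](minn_idPl aN); have E M : \sum_(r < M) (r < a) = minn a M.
    elim: M => [|M IH]; first by rewrite big_ord0 minn0.
    by rewrite (sum_ordS (fun r => nat_of_bool (r < a))) IH; case: (ltnP M a); lia.
  exact: E.
case: (ltnP j be._[0]) => j0.
  by apply: (allP ev); apply/mapP; exists j; rewrite // mem_iota -nth0.
(* Here column [j] of [be] is empty; in the previous case its height was a part of the conjugate
   partition. *)
have := part_gt_count be 0 j; rewrite ltnNge j0 => /esym/negbT; rewrite -leqNgt leqn0 => /eqP -> //.
Qed.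

End LRShapes.

Section Expansion.
Local Open Scope ring_scope.
Implicit Types (la be nu mu : intpart) (m : monomial).

Lemma monomial_bound m : exists N, forall i, (N <= i)%N -> m i = 0%N.
Proof.
exists (\max_(i <- finsupp m) i).+1 => i lt; apply: fsfun_dflt; apply/negP => im.
by have := @leq_bigmax_seq _ _ xpredT id i im isT; rewrite leqNgt lt.
Qed.

Lemma coef_mon_kron D N (w m : nat -> nat) : (1 < D)%N ->
  (forall i, (i < N)%N -> w i < D)%N -> (forall i, (i < N)%N -> m i < D)%N ->
  (mon (kron D) N w)`_(code D N m) = (agree N w m)%:R.
Proof. by move=> D1 hw hm; rewrite mon_kron coefXn eq_sym code_inj. Qed.

Lemma coef_schur_eval D N nu m : (1 < D)%N -> (forall i, (N <= i)%N -> m i = 0%N) ->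
  (forall i, (i < N)%N -> m i < D)%N -> (psize nu < D)%N ->
  (schur_eval (kron D) N nu)`_(code D N m) = schur nu m.
Proof.
move=> D1 m0 mD nuD; rewrite (schur_sum _ m0) coef_sum big_seq [RHS]big_seq; apply: eq_bigr => T Tin.
rewrite coef_mon_kron // ?exp_monomial_eq // => i _; exact: leq_ltn_trans (chain_wt_le _ Tin) nuD.
Qed.

Lemma coef_schur_mul D N be la m : (1 < D)%N -> (forall i, (N <= i)%N -> m i = 0%N) ->
  (forall i, (i < N)%N -> m i < D)%N -> (psize be + psize la < D)%N ->
  (schur_eval (kron D) N be * schur_eval (kron D) N la)`_(code D N m) = fps_mul (schur be) (schur la) m.
Proof.
move=> D1 m0 mD lD; rewrite (fps_mul_schur _ _ m0) /schur_eval big_distrl coef_sum /=.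
rewrite big_seq [RHS]big_seq; apply: eq_bigr => T Tin; rewrite big_distrr coef_sum /=.
rewrite big_seq [RHS]big_seq; apply: eq_bigr => T' Tin'.
have -> : mon (kron D) N (wt T) * mon (kron D) N (wt T') = mon (kron D) N (fun i => wt T i + wt T' i)%N.
  by rewrite /mon -big_split; apply: eq_bigr => i _; rewrite /= exprD.
apply: coef_mon_kron => // i _; apply: leq_ltn_trans lD.
by apply: leq_add; [apply: chain_wt_le Tin | apply: chain_wt_le Tin'].
Qed.

Lemma fps_mul_lr be la m : fps_mul (schur be) (schur la) m = \sum_(nu <- lr_shapes be la) schur nu m.
Proof.
have [N1 m1] := monomial_bound m; pose N := maxn N1 (size la + psize be).
have m0 i : (N <= i)%N -> m i = 0%N by rewrite geq_max => /andP[/m1].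
(* [D] exceeds the exponents of [m] and the degree of the product, so the digits never carry; the
   summand 2 ensures [1 < D]. *)
pose D := (2 + psize be + psize la + \sum_(i < N) m i)%N.
have D1 : (1 < D)%N by rewrite /D; lia.
have mD i : (i < N)%N -> (m i < D)%N.
  by move=> iN; rewrite /D (bigD1 (Ordinal iN)) //=; lia.
have leN : (size la + psize be <= N)%N by apply: leq_maxr.
have laN : (size la <= N)%N by apply: leq_trans leN; apply: leq_addr.
rewrite -(coef_schur_mul D1 m0 mD); last by rewrite /D; lia.
rewrite (schur_mul poly_two_neq0 (kron_inj D1)) // coef_sum -(big_lr_shapes _ leN).
rewrite big_seq_cond [RHS]big_seq_cond; apply: eq_bigr => T /andP[Tin gT].
by rewrite (coef_schur_eval D1 m0 mD) // (psize_add_wt laN Tin gT) /D; lia.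
Qed.

Lemma big_undup_count (V : nmodType) (I : eqType) (s : seq I) (F : I -> V) :
  \sum_(i <- undup s) F i *+ count_mem i s = \sum_(i <- s) F i.
Proof. exact: (@big_undup_iterop_count _ _ +%R). Qed.

Lemma fpsMzE (f : fps) (k : int) m : (f *~ k) m = f m * k.
Proof.
have E n : (f *+ n) m = f m * n%:Z by rewrite natmulfctE -natz mulr_natr.
case: k => n; first exact: E.
by rewrite NegzE mulrNz mulrN -E.
Qed.

Lemma schur_expansion_count (s : seq intpart) :
  schur_expansion (fun m => \sum_(nu <- s) schur nu m) (fun nu => Posz (count_mem nu s)).
Proof.
have sub nu : Posz (count_mem nu s) != 0 -> nu \in s by rewrite -has_pred1 has_count; case: count.
split; first by apply: sub_finite_set (finite_seq s) => nu /sub.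
rewrite (fsbigE (undup s)) ?undup_uniq //; last first.
  move=> nu _; rewrite mem_undup => nin; suff -> : count_mem nu s = 0%N by rewrite mulr0z.
  by apply/eqP; apply: contraNT nin => h; apply: sub.
rewrite (eq_bigl xpredT) => [|nu]; last exact: in_setT.
apply: funext => m; rewrite fct_sumE -big_undup_count; apply: eq_bigr => nu _.
by rewrite fpsMzE -natz mulr_natr.
Qed.

End Expansion.

(** * Linear independence of Schur functions *)

Section Uniqueness.
Local Open Scope nat_scope.
Implicit Types (la be nu mu : intpart) (m : monomial).

(** Dominance compares the inner sums one by one; their total is a numerical invariant, monotone for
    dominance, that can be maximised. *)
Definition partial_sums N nu := \sum_(k < N.+1) \sum_(i < k) nu._[i].

(* If x^mu occurs in s_nu then nu dominates mu. *)
Lemma chain_dominance N nu mu T : T \in chains N nu -> size mu <= N ->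
  (forall i, i < N -> wt T i = mu._[i]) ->
  partial_sums N nu <= partial_sums N mu -> nu = mu.
Proof.
move=> Tin muN wE le.
have dom (k : 'I_N.+1) : \sum_(i < k) mu._[i] <= \sum_(i < k) nu._[i].
  have -> : \sum_(i < k) mu._[i] = psize (T k).
    by rewrite (chain_psize _ Tin); apply: eq_bigr => i _; rewrite wE // (leq_trans (ltn_ord i)) // -ltnS.
  rewrite (psizeE (chain_size _ Tin)); apply: leq_sum => i _; exact: chain_sub Tin.
(* Termwise inequalities whose totals compare the other way round are all equalities. *)
have eq_k (k : 'I_N.+1) : \sum_(i < k) mu._[i] = \sum_(i < k) nu._[i].
  have /leqif_sum h : forall k : 'I_N.+1, true ->
      \sum_(i < k) mu._[i] <= \sum_(i < k) nu._[i] ?= iff (\sum_(i < k) mu._[i] == \sum_(i < k) nu._[i]).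
    by move=> k' _; apply: leqif_eq.
  move: (geq_leqif h); rewrite -/(partial_sums N nu) -/(partial_sums N mu) le => /esym/forallP/(_ k).
  by move/eqP.
apply: intpart_eqP => i; case: (ltnP i N) => iN; last first.
  by rewrite !part_eq0 ?(leq_trans muN) // (leq_trans (chains_size Tin)).
have iN1 : i < N.+1 by apply: ltnW.
have := eq_k (Ordinal (iN : i.+1 < N.+1)); have := eq_k (Ordinal iN1) => /= e.
rewrite (sum_ordS (fun r => mu._[r])) (sum_ordS (fun r => nu._[r])) e.
by move/addnI.
Qed.

Local Open Scope ring_scope.

(** Take [mu] of maximal [partial_sums] among those with [d mu != 0]. The monomial x^mu occurs in
    the Schur function of [mu], through the superstandard tableau, and by [chain_dominance] in no
    other one of the combination. *)
Lemma schur_independent (r : seq intpart) (d : intpart -> int) : uniq r ->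
  (forall m, \sum_(nu <- r) schur nu m * d nu = 0) -> forall nu, nu \in r -> d nu = 0.
Proof.
move=> ur h nu nur; apply/eqP/negPn/negP => dnu.
pose N := (\sum_(nu <- r) size nu)%N.
have sizeN mu : mu \in r -> (size mu <= N)%N.
  by move=> mur; rewrite /N (bigD1_seq mu) //= leq_addr.
have ex : exists k, has (fun mu => (d mu != 0) && (partial_sums N mu == k)) r.
  by exists (partial_sums N nu); apply/hasP; exists nu; rewrite // dnu eqxx.
have ub k : has (fun mu => (d mu != 0) && (partial_sums N mu == k)) r ->
    (k <= \sum_(mu <- r) partial_sums N mu)%N.
  by case/hasP=> mu mur /andP[_ /eqP <-]; rewrite (bigD1_seq mu) //= leq_addr.
case: (ex_maxnP ex ub) => k /hasP[mu mur /andP[dmu /eqP ek]] mx.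
have muN := sizeN mu mur.
pose m := exp_monomial N (fun i => mu._[i]).
have m0 i : (N <= i)%N -> m i = 0%N by rewrite exp_monomialE leqNgt => /negbTE ->.
have := h m; rewrite (bigD1_seq mu) //= big_seq_cond big1 ?addr0 => [|ka /andP[kar kamu]]; last first.
  have [->|dka] := eqVneq (d ka) 0; first by rewrite mulr0.
  rewrite (schur_count _ m0) (_ : filter _ _ = [::]) ?mul0r //.
  apply/eqP; rewrite -size_eq0 size_filter -leqn0 leqNgt -has_count; apply/hasPn => T Tin.
  apply/negP => /agreeP wE; case/eqP: kamu.
  apply: (chain_dominance Tin muN) => [i iN|]; first by rewrite wE // exp_monomialE iN.
  by rewrite ek; apply: mx; apply/hasP; exists ka; rewrite // dka eqxx.
move/eqP; rewrite mulf_eq0 (negbTE dmu) orbF (schur_count _ m0) => /eqP [] /eqP.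
rewrite size_filter -leqn0 leqNgt -has_count => /hasPn/(_ _ (superstandard_chain muN)) /negP; apply.
by apply/agreeP => i iN; rewrite exp_monomialE iN (superstandard_wt _ muN).
Qed.

Lemma schur_expansion_eval f c (r : seq intpart) m : schur_expansion f c -> uniq r ->
  (forall nu, c nu != 0 -> nu \in r) -> f m = \sum_(nu <- r) schur nu m * c nu.
Proof.
case=> _ -> ur h; rewrite (fsbigE r) //; last first.
  by move=> nu _ nin; have [->|/h] := eqVneq (c nu) 0; [rewrite mulr0z | rewrite (negbTE nin)].
rewrite (eq_bigl xpredT) => [|nu]; last exact: in_setT.
by rewrite fct_sumE; apply: eq_bigr => nu _; rewrite fpsMzE.
Qed.

Lemma schur_expansion_unique f c c' : schur_expansion f c -> schur_expansion f c' -> c = c'.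
Proof.
move=> ec ec'; case: (ec) (ec') => fc _ [fc' _].
pose r := undup (fset_set [set nu | c nu != 0]%classic ++ fset_set [set nu | c' nu != 0]%classic).
have ur : uniq r by apply: undup_uniq.
have rc nu : c nu != 0 -> nu \in r.
  by move=> h; rewrite mem_undup mem_cat in_fset_set // mem_set.
have rc' nu : c' nu != 0 -> nu \in r.
  by move=> h; rewrite mem_undup mem_cat orbC in_fset_set // mem_set.
apply: funext => nu; case: (boolP (nu \in r)) => nur; last first.
  have := contraNN (@rc nu) nur; have := contraNN (@rc' nu) nur.
  by rewrite !negbK => /eqP -> /eqP ->.
apply/eqP; rewrite -subr_eq0; apply/eqP.
apply: (@schur_independent r (fun nu => c nu - c' nu) ur) => // m.
rewrite (eq_bigr (fun nu => schur nu m * c nu - schur nu m * c' nu)) => [|mu _]; last exact: mulrBr.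
by rewrite sumrB -(schur_expansion_eval m ec) // -(schur_expansion_eval m ec') // subrr.
Qed.

(** Uniqueness of the expansion identifies the chosen coefficients with the multiplicities from
    Stembridge's rule. *)
Lemma LR_count be la : LR be la = fun nu => Posz (count_mem nu (lr_shapes be la)).
Proof.
have e : schur_expansion (fps_mul (schur be) (schur la)) (fun nu => Posz (count_mem nu (lr_shapes be la))).
  rewrite (_ : fps_mul _ _ = fun m => \sum_(nu <- lr_shapes be la) schur nu m).
    exact: schur_expansion_count.
  by apply: funext => m; apply: fps_mul_lr.
by apply: xget_unique => // c ec; apply: schur_expansion_unique ec e.
Qed.

End Uniqueness.

(** * The Schur expansion of the SSOT series *)

Section SSOTExpansion.
Local Open Scope ring_scope.
Implicit Types (la be nu mu : intpart) (m : monomial).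

Definition even_column_parts la n : seq intpart :=
  [seq be <- small_parts n | even_parts (conj_part be) && (psize la + psize be == n)%N].

Lemma ss_sum la n m : (psize la <= n)%N ->
  ss la n m = \sum_(be <- even_column_parts la n) \sum_(nu <- lr_shapes be la) schur nu m.
Proof.
move=> lan; have [N m0] := monomial_bound m.
pose D := (2 + n + \sum_(i < N) m i)%N.
have D1 : (1 < D)%N by rewrite /D; lia.
have mD i : (i < N)%N -> (m i < D)%N.
  by move=> iN; rewrite /D (bigD1 (Ordinal iN)) //=; lia.
rewrite (ss_count _ m0 (leqnn n)) -(@coef_kron D D1 N) //; last first.
  move=> c _ /eqP en i iN; rewrite /D -en (bigD1 (Ordinal iN)) //=; lia.
rewrite -/(osc_sum (kron D) n N la n) (osc_sumE poly_two_neq0 (kron_inj D1)) // lan.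
rewrite /even_sum big_distrl coef_sum /= /even_column_parts big_filter.
rewrite (@big_small_parts _ _ _ _ (fun be => even_parts (conj_part be) && (psize la + psize be == n)%N) n); last first.
  by move=> be; case: even_parts => //=; apply/andP/andP => -[/eqP h1 h2]; split; try apply/eqP; lia.
rewrite big_seq_cond [RHS]big_seq_cond; apply: eq_bigr => be /andP[_ /andP[_ /eqP ps]].
by rewrite (coef_schur_mul D1 m0 mD) ?fps_mul_lr // /D; lia.
Qed.

End SSOTExpansion.

Unset Implicit Arguments.
Local Open Scope classical_set_scope.
Local Open Scope ring_scope.

Theorem theorem4p5 (la : intpart) (n : nat) (hn : Nset la n) :
  let P := [set bn : intpart * intpart |
              even_parts (conj_part bn.1) /\ Vset n la bn.2] in
  [/\ finite_set [set bn | P bn /\ LR bn.1 la bn.2 != 0],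
      ss la n = \sum_(bn \in P) schur bn.2 *~ LR bn.1 la bn.2 &
      schur_positive (ss la n)].
Proof.
move=> P; have [lan _] := hn.
(* The pairs with a nonzero coefficient; repeated shapes are merged because [LR] already carries the
   multiplicity. *)
pose r := [seq (be, nu) | be <- even_column_parts la n, nu <- undup (lr_shapes be la)].
have inr (bn : intpart * intpart) : P bn -> LR bn.1 la bn.2 != 0 -> bn \in r.
  case: bn => be nu [/= ev [ps _]]; rewrite LR_count => c0.
  have nuin : nu \in lr_shapes be la by rewrite -has_pred1 has_count; case: count c0.
  have ps' := psize_lr_shapes nuin.
  apply/allpairsPdep; exists be, nu; split=> //; last by rewrite mem_undup.
  by rewrite mem_filter mem_small_parts ev -ps' ps eqxx /= -ps ps' leq_addl.
(* All shapes occurring for a [be] with even columns lie in [Vset n la], so the sum over [lr_shapes]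
   is a sum over [P]. *)
have rP (bn : intpart * intpart) : bn \in r -> P bn.
  case/allpairsPdep => be [nu [+ + ->]]; rewrite mem_filter mem_undup.
  by move=> /andP[/andP[ev /eqP en] _] nuin; split=> //=; rewrite -en; apply: lr_shapes_Vset.
split.
- by apply: sub_finite_set (finite_seq r) => bn [] /inr.
- rewrite (fsbigE r) //; first last.
  + by move=> bn Pbn nin; have [->|/(inr _ Pbn)] := eqVneq (LR bn.1 la bn.2) 0; [rewrite mulr0z | rewrite (negbTE nin)].
  + apply: allpairs_uniq_dep => [|be _|]; [exact/filter_uniq/uniq_small_parts | exact: undup_uniq |].
    by move=> [a b] [a' b'] _ _ /= [-> ->].
  rewrite big_seq_cond (eq_bigl (fun bn => bn \in r)) -?big_seq => [|bn]; last first.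
    by case: (boolP (bn \in r)) => //= /rP; rewrite -in_setE.
  apply: funext => m; rewrite ss_sum // fct_sumE big_allpairs_dep /=.
  apply: eq_bigr => be _; rewrite -big_undup_count; apply: eq_bigr => nu _.
  by rewrite fpsMzE LR_count -natz mulr_natr.
(* The coefficients are multiplicities in the concatenated list of shapes, hence nonnegative. *)
- exists (fun nu => Posz (count_mem nu (flatten [seq lr_shapes be la | be <- even_column_parts la n]))).
  split=> // ; rewrite (_ : ss la n =
    fun m => \sum_(nu <- flatten [seq lr_shapes be la | be <- even_column_parts la n]) schur nu m).
    exact: schur_expansion_count.
  by apply: funext => m; rewrite ss_sum // big_flatten big_map.
Qed.
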